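(* Let $\mathbf{k}\subset\mathbf{K}$ be two fields, where $\mathbf{k}$ is computable, let $x=(x_1,\ldots,x_n)$ and let $I$ be an ideal in $\mathbf{k}[x]$ (given by finitely many generators). There exists an algorithm for computing a finite partition $\mathbf{K}^n=\bigcup_k W_k$ into constructible sets defined over $\mathbf{k}[x]$ (i.e. by polynomials in $\mathbf{k}[x]$) such that, for any $W_k$, the map $W_k\ni x_0\mapsto \mathrm{HSF}_{I,x_0}$ is constant.
   Context: For $x_0\in\mathbf{K}^n$, let $\mathbf{K}[[x-x_0]]=\mathbf{K}[[x_1-x_{0,1},\ldots,x_n-x_{0,n}]]$ be the ring of formal power series at $x_0$ and $m_{x_0}$ its maximal ideal. The local Hilbert-Samuel function of $I$ at $x_0$ is the function $\mathrm{HSF}_{I,x_0}:\mathbb{N}\to\mathbb{N}$, $\mathrm{HSF}_{I,x_0}(r)=\dim_{\mathbf{K}}\big(\mathbf{K}[[x-x_0]]/(\mathbf{K}[[x-x_0]]\,I+m_{x_0}^r)\big)$. *)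

(* Defs.v *)
From HB Require Import structures.
From mathcomp Require Export all_boot all_order all_algebra.
From mathcomp Require Import boolp.
From mathcomp Require Export mpoly.
Set Implicit Arguments.
Unset Strict Implicit.
Unset Printing Implicit Defensive.
Import GRing.Theory.
#[export] Set Implicit Arguments.
#[export] Unset Strict Implicit.

Local Open Scope ring_scope.

(* The model of computation is a WHILE language on finite binary trees.
   A program acts on a single tree; [Loop p q] iterates [q] as long as the
   value of [p] on the current tree is not a leaf.  The language is Turing
   complete, and [run p t u] means that [p], started on [t], halts with
   result [u]. *)
Inductive tree : Type := Leaf | Node of tree & tree.

Definition left_tree (t : tree) : tree := if t is Node a _ then a else Leaf.
Definition right_tree (t : tree) : tree := if t is Node _ b then b else Leaf.

Inductive prog : Type :=
| Const of tree
| Id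
| Left
| Right
| Pair of prog & prog
| Seq of prog & prog
| Loop of prog & prog.

Inductive run : prog -> tree -> tree -> Prop :=
| run_const c t : run (Const c) t c
| run_id t : run Id t t
| run_left t : run Left t (left_tree t)
| run_right t : run Right t (right_tree t)
| run_pair p q t a b : run p t a -> run q t b -> run (Pair p q) t (Node a b)
| run_seq p q t u v : run p t u -> run q u v -> run (Seq p q) t v
| run_loop_stop p q t : run p t Leaf -> run (Loop p q) t t
| run_loop_step p q t a b u v :
    run p t (Node a b) -> run q t u -> run (Loop p q) u v ->
    run (Loop p q) t v.

Definition tree_of_nat (n : nat) : tree := iter n (Node Leaf) Leaf.

Definition tree_of_bool (b : bool) : tree := tree_of_nat b.

Definition tree_of_seq (T : Type) (f : T -> tree) (s : seq T) : tree :=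
  foldr (fun x => Node (f x)) Leaf s.

(* A field is computable if its elements can be named by trees in such a way
   that the set of names is decidable and the field operations are computable.
   Equality is then decidable as well, since names are unique. *)
Record computable_field (k : fieldType) (code : k -> tree) : Prop :=
  ComputableField {
    code_inj : injective code;
    code_image : exists p, forall t, exists2 b : bool,
      run p t (tree_of_bool b) & (b <-> exists a, code a = t);
    code_add : exists p, forall a b,
      run p (Node (code a) (code b)) (code (a + b));
    code_opp : exists p, forall a, run p (code a) (code (- a));
    code_mul : exists p, forall a b,
      run p (Node (code a) (code b)) (code (a * b));
    code_inv : exists p, forall a, a != 0 -> run p (code a) (code a^-1)
  }.

(* Finite presentations of polynomials as lists of terms; several terms may
   carry the same monomial, and coefficients may vanish. *)
Definition pol (k : fieldType) (n : nat) := seq (k * 'X_{1..n}).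

Definition mpoly_of_pol (k : fieldType) n (s : pol k n) : {mpoly k[n]} :=
  \sum_(t <- s) t.1 *: 'X_[t.2].

Definition tree_of_pol (k : fieldType) (code : k -> tree) n (s : pol k n) :
    tree :=
  tree_of_seq
    (fun t : k * 'X_{1..n} => Node (code t.1) (tree_of_seq tree_of_nat t.2)) s.

(* The list [(E_1, F_1), ..., (E_m, F_m)] presents the constructible set
   that is the union of the locally closed sets V(E_i) \ V(F_i). *)
Definition constr (k : fieldType) (n : nat) :=
  seq (seq (pol k n) * seq (pol k n)).

Definition tree_of_constr (k : fieldType) (code : k -> tree) n
    (W : constr k n) : tree :=
  tree_of_seq (fun EF => Node (tree_of_seq (@tree_of_pol k code n) EF.1)
                              (tree_of_seq (@tree_of_pol k code n) EF.2)) W.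

Section Points.
Variables (k K : fieldType) (iota : {rmorphism k -> K}) (n : nat).

Definition zero_at (x : 'I_n -> K) (s : pol k n) : bool :=
  (map_mpoly iota (mpoly_of_pol s)).@[x] == 0.

Definition in_constr (W : constr k n) (x : 'I_n -> K) : bool :=
  has (fun EF => all (zero_at x) EF.1 && ~~ all (zero_at x) EF.2) W.

(* Members of a partition may be empty: whether a given constructible set has
   a point with coordinates in K cannot be decided in general. *)
Definition is_partition (Ws : seq (constr k n)) : Prop :=
  forall x : 'I_n -> K, exists! i : 'I_(size Ws), in_constr (nth [::] Ws i) x.

End Points.

Section Ideals.
Variable R : comNzRingType.
Implicit Types A B : R -> Prop.

Definition ideal_gen A (a : R) : Prop :=
  exists2 s : seq (R * R),
    forall p, p \in s -> A p.2 & a = \sum_(p <- s) p.1 * p.2.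

Definition ideal_add A B (a : R) : Prop :=
  exists b c, [/\ A b, B c & a = b + c].

Definition ideal_mul A B : R -> Prop :=
  ideal_gen (fun a => exists b c, [/\ A b, B c & a = b * c]).

Fixpoint ideal_pow A (r : nat) : R -> Prop :=
  if r is r'.+1 then ideal_mul A (ideal_pow A r') else fun=> True.

End Ideals.

(* The ring R[[y_1, ..., y_n]]; a series is the family of its coefficients. *)
Definition fps (R : Type) (n : nat) := 'X_{1..n} -> R.

Section PowerSeries.
Variables (R : comNzRingType) (n : nat).
Implicit Types (f g h : fps R n) (m : 'X_{1..n}).

Definition fps_zero : fps R n := fun=> 0.
Definition fps_one : fps R n := fun m => (m == 0%MM)%:R.
Definition fps_opp f : fps R n := fun m => - f m.
Definition fps_add f g : fps R n := fun m => f m + g m.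
Definition fps_scale (c : R) f : fps R n := fun m => c * f m.
Definition fps_mul f g : fps R n := fun m =>
  \sum_(k : 'X_{1..n < (mdeg m).+1, (mdeg m).+1} | m == (k.1 + k.2)%MM)
    f k.1 * g k.2.

HB.instance Definition _ := gen_eqMixin (fps R n).
HB.instance Definition _ := gen_choiceMixin (fps R n).

Fact fps_addA : associative fps_add.
Proof. by move=> f g h; apply/funext => m; rewrite /fps_add addrA. Qed.
Fact fps_addC : commutative fps_add.
Proof. by move=> f g; apply/funext => m; rewrite /fps_add addrC. Qed.
Fact fps_add0 : left_id fps_zero fps_add.
Proof. by move=> f; apply/funext => m; rewrite /fps_add add0r. Qed.
Fact fps_addN : left_inverse fps_zero fps_opp fps_add.
Proof. by move=> f; apply/funext => m; rewrite /fps_add addNr. Qed.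

HB.instance Definition _ := GRing.isZmodule.Build (fps R n)
  fps_addA fps_addC fps_add0 fps_addN.

(* The multiplicative axioms are transported from polynomials by truncation. *)
Let trunc d f : {mpoly R[n]} := \sum_(m : 'X_{1..n < d}) f m *: 'X_[m].

Let fps_mulE f g m (p q : {mpoly R[n]}) :
  (forall l, mdeg l <= mdeg m -> p@_l = f l)%N ->
  (forall l, mdeg l <= mdeg m -> q@_l = g l)%N ->
  fps_mul f g m = (p * q)@_m.
Proof.
move=> pf qg; rewrite mcoeffM; apply: eq_bigr => -[l1 l2] _ /=.
by rewrite pf ?qg // -ltnS bmdeg.
Qed.

Let truncE f m l : (mdeg l <= mdeg m)%N -> (trunc (mdeg m).+1 f)@_l = f l.
Proof. by move=> le_lm; rewrite mcoeff_mpoly. Qed.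

Let fps_mul_trunc f g m l : (mdeg l <= mdeg m)%N ->
  (trunc (mdeg m).+1 f * trunc (mdeg m).+1 g)@_l = fps_mul f g l.
Proof.
by move=> le_lm; apply/esym/fps_mulE => j le_jl; rewrite truncE //;
  apply: leq_trans le_lm.
Qed.

Fact fps_mulA : associative fps_mul.
Proof.
move=> f g h; apply/funext => m; pose t := trunc (mdeg m).+1.
rewrite (@fps_mulE _ _ _ (t f) (t g * t h)); first last.
- exact: fps_mul_trunc.
- exact: truncE.
rewrite mulrA (@fps_mulE _ _ _ (t f * t g) (t h)) //.
- exact: fps_mul_trunc.
- exact: truncE.
Qed.

Fact fps_mulC : commutative fps_mul.
Proof.
move=> f g; apply/funext => m; pose t := trunc (mdeg m).+1.
by rewrite -[LHS](@fps_mul_trunc _ _ m) // mulrC fps_mul_trunc.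
Qed.

Fact fps_mul1 : left_id fps_one fps_mul.
Proof.
move=> f; apply/funext => m; pose t := trunc (mdeg m).+1.
rewrite (@fps_mulE _ _ _ 1 (t f)) ?mul1r; first exact: truncE.
- by move=> l _; rewrite mcoeff1.
- exact: truncE.
Qed.

Fact fps_mulD : left_distributive fps_mul fps_add.
Proof.
move=> f g h; apply/funext => m; rewrite /fps_mul /fps_add -big_split /=.
by apply: eq_bigr => l _; rewrite mulrDl.
Qed.

Fact fps_1_neq0 : fps_one != 0.
Proof.
by apply/eqP => /(congr1 (@^~ 0%MM))/eqP; rewrite /fps_one eqxx oner_eq0.
Qed.

HB.instance Definition _ := GRing.Zmodule_isComNzRing.Build (fps R n)
  fps_mulA fps_mulC fps_mul1 fps_mulD fps_1_neq0.

Fact fps_scaleA a b f : fps_scale a (fps_scale b f) = fps_scale (a * b) f.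
Proof. by apply/funext => m; rewrite /fps_scale mulrA. Qed.
Fact fps_scale1 : left_id 1 fps_scale.
Proof. by move=> f; apply/funext => m; rewrite /fps_scale mul1r. Qed.
Fact fps_scaleDr : right_distributive fps_scale +%R.
Proof. by move=> c f g; apply/funext => m; rewrite [LHS]mulrDr. Qed.
Fact fps_scaleDl f : {morph fps_scale^~ f : a b / a + b}.
Proof. by move=> a b; apply/funext => m; rewrite [LHS]mulrDl. Qed.

HB.instance Definition _ := GRing.Zmodule_isLmodule.Build R (fps R n)
  fps_scaleA fps_scale1 fps_scaleDr fps_scaleDl.

Definition fps_max_ideal f : Prop := f 0%MM = 0.

End PowerSeries.

(* [e] is a basis of the quotient of V by the subspace U. *)
Definition quotient_dim (K : fieldType) (V : lmodType K) (U : V -> Prop)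
    (d : nat) : Prop :=
  exists e : 'I_d -> V, forall v : V,
    exists! c : 'rV[K]_d, U (v - \sum_i c 0 i *: e i).

Section HilbertSamuel.
Variables (k K : fieldType) (iota : {rmorphism k -> K}) (n : nat).

(* The embedding of k[x] into K[[x - x0]], the latter being identified with
   K[[y]] through x = x0 + y. *)
Definition expand_at (x0 : 'I_n -> K) (p : {mpoly k[n]}) : fps K n :=
  fun m =>
    (map_mpoly iota p \mPo [tuple ('X_i + (x0 i)%:MP : {mpoly K[n]}) | i < n])@_m.

Definition extended_ideal (I : {mpoly k[n]} -> Prop) (x0 : 'I_n -> K) :
    fps K n -> Prop :=
  ideal_gen (fun s => exists2 p, I p & s = expand_at x0 p).

(* [h] is the local Hilbert-Samuel function of [I] at [x0]. *)
Definition is_HSF (I : {mpoly k[n]} -> Prop) (x0 : 'I_n -> K) (h : nat -> nat) :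
    Prop :=
  forall r, quotient_dim
    (ideal_add (extended_ideal I x0) (ideal_pow (@fps_max_ideal K n) r)) (h r).

End HilbertSamuel.

Definition ideal_of_pols (k : fieldType) n (gens : seq (pol k n)) :
    {mpoly k[n]} -> Prop :=
  ideal_gen (fun p => exists2 s, s \in gens & p = mpoly_of_pol s).

(* Main.v *)
(* Fix a point [x0] and let [L(x0)] be the set of exponents of initial (that is,
   smallest, for a degree-refining monomial order) terms of polynomials in the
   ideal generated by the Taylor expansions [f_i(x0 + y)].  The monomials of
   degree [< r] outside [L(x0)] form a basis of the quotient that defines
   HSF(r), so it is enough to stratify by [L(x0)].

   Degree bound.  Filter the ideal by [W_e], the span of the [y^u f_i(x0 + y)]
   with [d + |u| <= e], and attach to [y^b] in [W_e] the homogenised monomial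
   [t^(e - |b|) y^b].  As in Buchberger's criterion, if the homogenised initial
   monomials up to degree [2D] are all divisible by some of degree [<= D], then
   this holds in every degree, and [L(x0)] is generated in degree [<= D].  If
   this fails for [D = c, 2c, ..., 2^(i-1) c], the successive obstructions form
   a sequence of monomials none of which divides a later one, and whose [j]-th
   term has exponents at most [2^(j+1) c].  By Dickson's and Koenig's lemmas
   such sequences have bounded length, so a search for all of them terminates
   and yields a [D] which serves all [x0] at once.

   Stratification.  The part of [L(x0)] of degree [<= D] consists of the pivot
   columns of a matrix whose entries are polynomials in [x0].  Follow all
   possible courses of a division-free Gaussian elimination and collect the
   candidate pivots: which of these polynomials vanish at [x0] determines
   [L(x0)], and the strata are indexed by the subsets of them that vanish. *)
Require Import Defs.
From HB Require Import structures.
From mathcomp Require Import boolp zify.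
Set Implicit Arguments.
Unset Strict Implicit.
Unset Printing Implicit Defensive.
Import Order.TTheory GRing.Theory.

(** * Computable functions on encoded data *)

(** With a type class the encodings of nested pairs and lists are inferred from the types, and they
    unfold to the trees of the statement. *)
Class encodable (A : Type) := encode : A -> tree.

#[global] Instance encodable_unit : encodable unit := fun=> Leaf.
#[global] Instance encodable_nat : encodable nat := tree_of_nat.
#[global] Instance encodable_bool : encodable bool := tree_of_bool.
#[global] Instance encodable_prod A B `{encodable A} `{encodable B} :
  encodable (A * B) := fun u => Node (encode u.1) (encode u.2).
#[global] Instance encodable_seq A `{encodable A} : encodable (seq A) :=
  tree_of_seq encode.

Definition computable A B `{encodable A} `{encodable B} (f : A -> B) : Prop :=
  exists p, forall a, run p (encode a) (encode (f a)).

Section Closure.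
Context {A : Type} {eA : encodable A}.

Lemma computable_id : computable (fun a : A => a).
Proof. by exists Id => a; exact: run_id. Qed.

Lemma computable_const B `{encodable B} (b : B) : computable (fun _ : A => b).
Proof. by exists (Const (encode b)) => a; exact: run_const. Qed.

Lemma computable_comp B C `{encodable B} `{encodable C}
    (g : B -> C) (f : A -> B) :
  computable g -> computable f -> computable (fun a => g (f a)).
Proof. by move=> [q Hq] [p Hp]; exists (Seq p q) => a; apply: run_seq. Qed.

Lemma computable_pair B C `{encodable B} `{encodable C}
    (f : A -> B) (g : A -> C) :
  computable f -> computable g -> computable (fun a => (f a, g a)).
Proof. by move=> [p Hp] [q Hq]; exists (Pair p q) => a; apply: run_pair. Qed.

(** This is for a loop whose number of rounds is not known beforehand. Halting is not asserted: the
    number [n] of rounds comes from the hypotheses. *)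
Lemma computable_while (test : A -> bool) (step : A -> A) :
  computable test -> computable step ->
  exists p, forall n a, (forall i, i < n -> test (iter i step a)) ->
    ~~ test (iter n step a) -> run p (encode a) (encode (iter n step a)).
Proof.
move=> [p Hp] [q Hq]; exists (Loop p q); elim=> [|n IHn] a Ht Hn.
  by apply: run_loop_stop; have := Hp a; rewrite (negbTE Hn).
rewrite iterSr; apply:
  (run_loop_step (a := Leaf) (b := Leaf)) (Hq a) (IHn _ _ _).
- by have := Hp a; rewrite (Ht 0 isT); apply.
- by move=> i lt_in; rewrite -iterSr; apply: Ht.
- by rewrite -iterSr.
Qed.

End Closure.

(** Numbers share the encoding of lists of units, which reduces iteration to a fold. *)
Lemma encode_nseq_tt n : encode (nseq n tt) = encode n.
Proof. by elim: n => // n /(congr1 (Node Leaf)). Qed.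

Section Primitives.
Context {X Y : Type} {eX : encodable X} {eY : encodable Y}.

Lemma computable_fst : computable (@fst X Y).
Proof. by exists Left => u; exact: (run_left (encode u)). Qed.

Lemma computable_snd : computable (@snd X Y).
Proof. by exists Right => u; exact: (run_right (encode u)). Qed.

(** A nonempty list has the same encoding as the pair of its head and its tail. *)
Lemma computable_cons : computable (fun u : X * seq X => u.1 :: u.2).
Proof. by exists Id => u; exact: (run_id (encode u)). Qed.

Lemma computable_behead : computable (@behead X).
Proof.
(* [right_tree] sends a leaf to a leaf, in agreement with [behead] on the empty list. *)
by exists Right => -[|x s];
  [exact: (run_right Leaf) | exact: (run_right (Node _ _))].
Qed.

Lemma computable_succn : computable succn.
Proof.
exists (Pair (Const Leaf) Id) => n.
exact: run_pair (run_const _ _) (run_id _).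
Qed.

Lemma computable_predn : computable predn.
Proof.
by exists Right => -[|n];
  [exact: (run_right Leaf) | exact: (run_right (Node _ _))].
Qed.

Lemma computable_nat_of_bool : computable nat_of_bool.
Proof. by exists Id => b; exact: run_id. Qed.

End Primitives.

Create HintDb computable.
#[global] Hint Resolve computable_fst computable_snd computable_cons
  computable_behead computable_succn computable_predn computable_nat_of_bool
  : computable.

Ltac computable_base :=
  first [ assumption
        | solve [eauto 3 with computable nocore typeclass_instances] ].

(* Peels off the head function of [fun a => h (x a) ...], uncurried. *)
Ltac computable_app :=
  match goal with
  | |- computable (fun a => (@?x a, @?y a)) =>
      refine (computable_pair (f := x) (g := y) _ _)
  | |- computable (fun a => ?h (@?x a) (@?y a) (@?z a)) =>
      refine (computable_comp (g := fun u => h u.1 u.2.1 u.2.2)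
                              (f := fun a => (x a, (y a, z a))) _ _);
      [computable_base | ]
  | |- computable (fun a => ?h (@?x a) (@?y a)) =>
      refine (computable_comp (g := fun u => h u.1 u.2)
                              (f := fun a => (x a, y a)) _ _);
      [computable_base | ]
  | |- computable (fun a => ?h (@?x a)) =>
      refine (computable_comp (g := h) (f := x) _ _); [computable_base | ]
  end.

(** The argument [step] treats higher-order operations; [computable] is redefined with a stronger
    [step] whenever more of them are available. *)
Ltac computable_with step :=
  cbv beta;
  first [ exact: computable_id | exact: computable_const | computable_base
        | (first [ computable_app | step tt ]);
          computable_with step ].

Section Folds.
Context {A : Type} {eA : encodable A}.

Lemma computable_foldl X Y `{encodable X} `{encodable Y}
    (f : A -> Y -> X -> Y) (i : A -> Y) (l : A -> seq X) :
  computable (fun u : A * (Y * X) => f u.1 u.2.1 u.2.2) ->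
  computable i -> computable l ->
  computable (fun a => foldl (f a) (i a) (l a)).
Proof.
move=> [p Hp] [pi Hi] [pl Hl].
(* The loop state consists of the parameter, the remaining list and the accumulator. The remaining
   list is also the loop test, being a leaf exactly when it is empty. *)
pose env := Left; pose lst := Seq Right Left; pose acc := Seq Right Right.
pose body := Pair env
  (Pair (Seq lst Right) (Seq (Pair env (Pair acc (Seq lst Left))) p)).
exists (Seq (Pair Id (Pair pl pi)) (Seq (Loop lst body) acc)) => a.
pose (st := fun (s : seq X) (y : Y) =>
  Node (encode a) (Node (encode s) (encode y))).
have Henv s y : run env (st s y) (encode a) by exact: (run_left (st s y)).
have Hlst s y : run lst (st s y) (encode s).
  by apply: run_seq (run_right _) _; exact: (run_left (Node _ _)).
have Hacc s y : run acc (st s y) (encode y).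
  by apply: run_seq (run_right _) _; exact: (run_right (Node _ _)).
apply: (run_seq (u := st (l a) (i a))).
  by apply: run_pair (run_id _) _; apply: run_pair.
apply: (run_seq (u := st [::] (foldl (f a) (i a) (l a)))) (Hacc _ _).
elim: (l a) (i a) => [|x s IHs] y /=; first exact: run_loop_stop (Hlst [::] y).
apply: run_loop_step (Hlst (x :: s) y) _ (IHs (f a y x)).
apply: run_pair (Henv _ _) _; apply: run_pair.
  apply: run_seq (Hlst _ _) _; exact: (run_right (Node _ _)).
apply: (run_seq (u := Node (encode a) (Node (encode y) (encode x))));
  last exact: (Hp (a, (y, x))).
apply: run_pair (Henv _ _) _; apply: run_pair (Hacc _ _) _.
by apply: run_seq (Hlst _ _) _; exact: (run_left (Node _ _)).
Qed.

Lemma computable_iter Y `{encodable Y} (n : A -> nat) (f : A -> Y -> Y)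
    (i : A -> Y) :
  computable n -> computable (fun u : A * Y => f u.1 u.2) -> computable i ->
  computable (fun a => iter (n a) (f a) (i a)).
Proof.
move=> [p Hp] Hf Hi.
have Hn : computable (fun a => nseq (n a) tt).
  by exists p => a; rewrite encode_nseq_tt.
have Hg : computable (fun u : A * (Y * unit) => f u.1 u.2.1).
  computable_with idtac.
have [q Hq] := computable_foldl (f := fun a y _ => f a y) Hg Hi Hn.
exists q => a; have := Hq a; congr (run _ _ (encode _)).
by elim: (n a) (i a) => //= m IHm y; rewrite IHm -iterSr.
Qed.

End Folds.

Lemma computable_rev X `{encodable X} : computable (@rev X).
Proof.
have [p Hp] : computable (foldl (fun t x => x :: t) [::] : seq X -> seq X).
  apply: (computable_foldl (f := fun _ t x => x :: t) (l := id));
    by computable_with idtac.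
exists p => s; have := Hp s; congr (run _ _ (encode _)).
by rewrite -[in LHS](revK s) foldl_rev; elim: (rev _) => //= x t ->.
Qed.
#[global] Hint Resolve computable_rev : computable.

Lemma computable_foldr A X Y `{encodable A} `{encodable X} `{encodable Y}
    (f : A -> X -> Y -> Y) (i : A -> Y) (l : A -> seq X) :
  computable (fun u : A * (X * Y) => f u.1 u.2.1 u.2.2) ->
  computable i -> computable l ->
  computable (fun a => foldr (f a) (i a) (l a)).
Proof.
move=> Hf Hi Hl.
have [p Hp] : computable (fun a => foldl (fun y x =>
  f a x y) (i a) (rev (l a))).
  apply: (computable_foldl (f := fun a y x => f a x y)) => //;
    by computable_with idtac.
by exists p => a; have := Hp a; rewrite foldl_rev.
Qed.

Lemma computable_ext A B `{encodable A} `{encodable B} (g f : A -> B) :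
  f =1 g -> computable g -> computable f.
Proof. by move=> fg [p Hp]; exists p => a; rewrite fg. Qed.

Ltac computable_fold _ :=
  lazymatch goal with
  | |- computable (fun a => foldr (@?f a) (@?x a) (@?y a)) =>
      apply: (computable_foldr (f := f))
  | |- computable (fun a => iter (@?n a) (@?f a) (@?x a)) =>
      apply: (computable_iter (f := f))
  end.

Ltac computable := computable_with computable_fold.

(** The language has no conditional; an iteration performed [b a] times, so zero times or once,
    takes its place. *)
Lemma computable_if A B `{encodable A} `{encodable B} (b : A -> bool)
    (f g : A -> B) :
  computable b -> computable f -> computable g ->
  computable (fun a => if b a then f a else g a).
Proof.
move=> Hb Hf Hg.
apply: (computable_ext (g := fun a => iter (b a) (fun=> f a) (g a))).
  by move=> a; case: (b a).
computable.
Qed.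

Ltac computable_case _ :=
  first [ computable_fold tt | refine (computable_if _ _ _) ].

Ltac computable ::= computable_with computable_case.

Section Lists.
Context {A X Y : Type} {eA : encodable A} {eX : encodable X} {eY : encodable Y}.

Lemma computable_map (f : A -> X -> Y) (s : A -> seq X) :
  computable (fun u : A * X => f u.1 u.2) -> computable s ->
  computable (fun a => map (f a) (s a)).
Proof.
move=> Hf Hs.
apply: (computable_ext (g := fun a => foldr (fun x t => f a x ::
  t) [::] (s a))).
  by move=> a; elim: (s a) => //= x r ->.
computable.
Qed.

Lemma computable_filter (p : A -> X -> bool) (s : A -> seq X) :
  computable (fun u : A * X => p u.1 u.2) -> computable s ->
  computable (fun a => filter (p a) (s a)).
Proof.
move=> Hp Hs; apply: (computable_ext
  (g := fun a => foldr (fun x t => if p a x then x :: t else t) [::] (s a))).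
  by move=> a; elim: (s a) => //= x r ->.
computable.
Qed.

Lemma computable_all (p : A -> X -> bool) (s : A -> seq X) :
  computable (fun u : A * X => p u.1 u.2) -> computable s ->
  computable (fun a => all (p a) (s a)).
Proof.
move=> Hp Hs; apply: (computable_ext
  (g := fun a => foldr (fun x b => if p a x then b else false) true (s a))).
  by move=> a; elim: (s a) => //= x r ->.
computable.
Qed.

End Lists.

Ltac computable_iterator _ :=
  lazymatch goal with
  | |- computable (fun a => map (@?f a) (@?s a)) =>
      apply: (computable_map (f := f))
  | |- computable (fun a => filter (@?p a) (@?s a)) =>
      apply: (computable_filter (p := p))
  | |- computable (fun a => all (@?p a) (@?s a)) =>
      apply: (computable_all (p := p))
  | _ => computable_case tt
  end.

Ltac computable ::= computable_with computable_iterator.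

Lemma computable_negb : computable negb.
Proof. by rewrite /negb; computable. Qed.

Lemma computable_andb : computable (fun u : bool * bool => u.1 && u.2).
Proof. by rewrite /andb; computable. Qed.

Lemma computable_addn : computable (fun u : nat * nat => u.1 + u.2).
Proof.
apply: (computable_ext (g := fun u => iter u.1 succn u.2)); last by computable.
by case=> m n; rewrite iter_succn addnC.
Qed.

Lemma computable_subn : computable (fun u : nat * nat => u.1 - u.2).
Proof.
apply: (computable_ext (g := fun u => iter u.2 predn u.1)); last by computable.
by case=> m; elim=> [|n IHn] /=; rewrite ?subn0 // subnS IHn.
Qed.
#[global] Hint Resolve computable_negb computable_andb computable_addn
  computable_subn : computable.

Lemma computable_muln : computable (fun u : nat * nat => u.1 * u.2).
Proof.
apply: (computable_ext (g := fun u => iter u.1 (addn u.2) 0));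
  last by computable.
by case=> m n; rewrite iter_addn_0 mulnC.
Qed.

Lemma computable_leq : computable (fun u : nat * nat => u.1 <= u.2).
Proof.
apply: (computable_ext (g := fun u => iter (u.1 - u.2) (fun=> false) true)).
  by case=> m n; rewrite /leq /=; case: (m - n).
computable.
Qed.
#[global] Hint Resolve computable_muln computable_leq : computable.

Lemma computable_eqn : computable (fun u : nat * nat => u.1 == u.2).
Proof.
apply: (computable_ext (g := fun u => (u.1 <= u.2) && (u.2 <= u.1))).
  by move=> u; rewrite eqn_leq.
computable.
Qed.
#[global] Hint Resolve computable_eqn : computable.

Section ListOperations.
Context {X : Type} {eX : encodable X}.

Lemma computable_cat : computable (fun u : seq X * seq X => u.1 ++ u.2).
Proof.
apply: (computable_ext (g := fun u => foldr cons u.2 u.1)); last by computable.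
by case=> s t; elim: s => //= x r ->.
Qed.

Lemma computable_size : computable (@size X).
Proof.
apply: (computable_ext (g := fun s => foldr (fun _ n => n.+1) 0 s));
  last by computable.
by elim=> //= x r ->.
Qed.

Lemma computable_head : computable (fun u : X * seq X => head u.1 u.2).
Proof.
apply: (computable_ext (g := fun u => foldr (fun x _ => x) u.1 u.2)).
  by case=> d [].
computable.
Qed.

Lemma computable_nseq : computable (fun u : nat * X => nseq u.1 u.2).
Proof.
apply: (computable_ext (g := fun u => iter u.1 (cons u.2) [::])).
  by case=> n x; elim: n => //= n ->.
computable.
Qed.

Lemma computable_nth : computable (fun u : X * (seq X * nat) =>
  nth u.1 u.2.1 u.2.2).
Proof.
have [p Hp] : computable (fun u : X * (seq X * nat) =>
    foldr (fun x _ => x) u.1 (iter u.2.2 behead u.2.1)) by computable.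
exists p => u; have := Hp u; congr (run _ _ (encode _)).
case: u => d [s i] /=; elim: i s => [[] //|i IHi s].
by rewrite iterSr IHi nth_behead.
Qed.

End ListOperations.
#[global] Hint Resolve computable_cat computable_size computable_head
  computable_nseq computable_nth : computable.

Lemma computable_flatten X `{encodable X} : computable (@flatten X).
Proof. by apply: (computable_ext (g := fun s => foldr cat [::] s));
  last computable. Qed.

Lemma computable_sumn : computable sumn.
Proof. by apply: (computable_ext (g := fun s => foldr addn 0 s));
  last computable. Qed.

Lemma computable_iota : computable (fun u : nat * nat => iota u.1 u.2).
Proof.
apply: (computable_ext (g := fun u =>
    rev (iter u.2 (fun s => (u.1 + size s) :: s) [::]))); last by computable.
case=> m n; elim: n => // n IHn; rewrite -addn1 iotaD IHn addn1 /= rev_cons.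
by rewrite -cats1 -(size_rev (iter _ _ _)) -IHn size_iota.
Qed.
#[global] Hint Resolve computable_flatten computable_sumn computable_iota
  : computable.

(** * The algorithm *)

(** The algorithm works with exponents as bare lists, since the number of variables is part of its
    input. *)
Definition mon_le (m1 m2 : seq nat) : bool :=
  all (fun i => nth 0 m1 i <= nth 0 m2 i) (iota 0 (size m1)).

Definition mon_sub (m1 m2 : seq nat) : seq nat :=
  [seq nth 0 m1 i - nth 0 m2 i | i <- iota 0 (size m1)].

Definition mon_add (m1 m2 : seq nat) : seq nat :=
  [seq nth 0 m1 i + nth 0 m2 i | i <- iota 0 (size m1)].

(** The enumeration is lexicographic, and [cols] relies on this. *)
Definition box (c N : nat) : seq (seq nat) :=
  iter N (fun l => [seq x :: s | x <- iota 0 c.+1, s <- l]) [:: [::]].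

(* One round of the search for sequences without divisibility; a sequence is
   stored latest term first, [st.1] is the current bound on the exponents. *)
Definition bad_step (N : nat) (st : nat * seq (seq (seq nat))) :
    nat * seq (seq (seq nat)) :=
  (st.1 + st.1,
   flatten [seq [seq m :: s | m <- [seq m <- box (st.1 + st.1) N |
                                     all (fun w => ~~ mon_le w m) s]]
           | s <- st.2]).

(* In increasing degree-lexicographic order, so that pivots of the matrix of jets
   are initial monomials. *)
Definition cols (n D : nat) : seq (seq nat) :=
  flatten [seq [seq b <- box D n | sumn b == r] | r <- iota 0 D.+1].

(* A binomial coefficient, in a form that is readily computable. *)
Definition bin (m c : nat) : nat := size [seq s <- box 1 m | sumn s == c].

Definition multibin (m c : seq nat) : nat :=
  foldr (fun i p => bin (nth 0 m i) (nth 0 c i) * p) 1 (iota 0 (size c)).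

Section Polynomials.
Variable k : fieldType.

Definition upol := seq (k * seq nat).

(** A sum replaces the maximum of the degrees: any upper bound can start the search. *)
Definition deg_bound (gens : seq upol) : nat :=
  (sumn (flatten [seq [seq sumn t.2 | t <- f] | f <- gens])).+1.

Definition pol_opp (p : upol) : upol := [seq (- t.1, t.2)%R | t <- p].

Definition pol_mul (p q : upol) : upol :=
  [seq ((t.1 * u.1)%R, mon_add t.2 u.2) | t <- p, u <- q].

Definition pol_prod (n : nat) (ps : seq upol) : upol :=
  foldr pol_mul [:: (1%R, nseq n 0)] ps.

(* The coefficient of [y^c] in [f(x + y)], as a polynomial in [x]; terms are
   repeated instead of being multiplied by an integer. *)
Definition taylor (f : upol) (c : seq nat) : upol :=
  flatten [seq nseq (multibin t.2 c) (t.1, mon_sub t.2 c) | t <- f].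

(** This is the coefficient of [y^b] in [y^a f(x + y)], as a polynomial in [x]. *)
Definition entry (f : upol) (a b : seq nat) : upol :=
  if mon_le a b then taylor f (mon_sub b a) else [::].

(** Multipliers [y^a] outside the box have degree above [D], so the rows already span the
    truncations of the whole ideal. *)
Definition jet_matrix (n D : nat) (gens : seq upol) : seq (seq upol) :=
  [seq [seq entry f a b | b <- cols n D] | f <- gens, a <- box D n].

(* The pivot row [r] is kept among the rows, where it becomes zero. *)
Definition reduce (r : seq upol) (rows : seq (seq upol)) : seq (seq upol) :=
  [seq [seq pol_mul (head [::] r) (nth [::] s j.+1) ++
            pol_opp (pol_mul (head [::] s) (nth [::] r j.+1))
       | j <- iota 0 (size r).-1] | s <- rows].

(* The matrices left after one column: either no row has a pivot there, or one
   of the rows is used as the pivot row. *)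
Definition branch (ms : seq (seq (seq upol))) : seq (seq (seq upol)) :=
  flatten [seq map behead rows :: [seq reduce r rows | r <- rows] | rows <- ms].

(** Every round of [branch] removes a column, so after [j] rounds column [j] comes first and its
    candidate pivots are the heads of the rows. *)
Definition pivots (q : nat) (M : seq (seq upol)) : seq upol :=
  flatten [seq flatten [seq map (head [::]) rows | rows <- iter j branch [:: M]]
          | j <- iota 0 q].

(** The first component collects the polynomials required to vanish, the second those required not
    to vanish. *)
Definition splits (P : seq upol) : seq (seq upol * seq upol) :=
  foldr (fun p ss => [seq (p :: s.1, s.2) | s <- ss] ++
                     [seq (s.1, p :: s.2) | s <- ss])
        [:: ([::], [::])] P.

(** Removing V(F) only says that some member of F is nonzero; taking the product as the sole member
    makes all the factors nonzero. *)
Definition strata (n D : nat) (gens : seq upol) :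
    seq (seq (seq upol * seq upol)) :=
  [seq [:: (s.1, [:: pol_prod n s.2])]
  | s <- splits (pivots (size (cols n D)) (jet_matrix n D gens))].

End Polynomials.

(** * Computability of the algorithm *)

Lemma computable_mon_le : computable (fun u => mon_le u.1 u.2).
Proof. by rewrite /mon_le; computable. Qed.

Lemma computable_mon_sub : computable (fun u => mon_sub u.1 u.2).
Proof. by rewrite /mon_sub; computable. Qed.

Lemma computable_mon_add : computable (fun u => mon_add u.1 u.2).
Proof. by rewrite /mon_add; computable. Qed.

Lemma computable_box : computable (fun u => box u.1 u.2).
Proof. by rewrite /box; computable. Qed.
#[global] Hint Resolve computable_mon_le computable_mon_sub computable_mon_add
  computable_box : computable.

Lemma computable_bad_step : computable (fun u => bad_step u.1 u.2).
Proof. by rewrite /bad_step; computable. Qed.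

Lemma computable_cols : computable (fun u => cols u.1 u.2).
Proof. by rewrite /cols; computable. Qed.

Lemma computable_bin : computable (fun u => bin u.1 u.2).
Proof. by rewrite /bin; computable. Qed.
#[global] Hint Resolve computable_bad_step computable_cols computable_bin
  : computable.

Lemma computable_multibin : computable (fun u => multibin u.1 u.2).
Proof. by rewrite /multibin; computable. Qed.
#[global] Hint Resolve computable_multibin : computable.

Section ComputablePolynomials.
Variables (k : fieldType) (code : k -> tree).
Hypothesis k_computable : computable_field code.
#[local] Instance encodable_field : encodable k := code.

Lemma computable_field_mul : computable (fun u : k * k => u.1 * u.2)%R.
Proof. by have [p Hp] := code_mul k_computable; exists p => u; exact: Hp. Qed.

Lemma computable_field_opp : computable (@GRing.opp k).
Proof. exact: code_opp k_computable. Qed.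
#[local] Hint Resolve computable_field_mul computable_field_opp : computable.

Lemma computable_deg_bound : computable (@deg_bound k).
Proof. by rewrite /deg_bound; computable. Qed.

Lemma computable_pol_opp : computable (@pol_opp k).
Proof. by rewrite /pol_opp; computable. Qed.

Lemma computable_pol_mul : computable (fun u => @pol_mul k u.1 u.2).
Proof. by rewrite /pol_mul; computable. Qed.

Lemma computable_taylor : computable (fun u => @taylor k u.1 u.2).
Proof. by rewrite /taylor; computable. Qed.

Lemma computable_splits : computable (@splits k).
Proof. by rewrite /splits; computable. Qed.
#[local] Hint Resolve computable_deg_bound computable_pol_opp computable_pol_mul
  computable_taylor computable_splits : computable.

Lemma computable_pol_prod : computable (fun u => @pol_prod k u.1 u.2).
Proof. by rewrite /pol_prod; computable. Qed.

Lemma computable_entry : computable (fun u => @entry k u.1 u.2.1 u.2.2).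
Proof. by rewrite /entry; computable. Qed.

Lemma computable_reduce : computable (fun u => @reduce k u.1 u.2).
Proof. by rewrite /reduce; computable. Qed.
#[local] Hint Resolve computable_pol_prod computable_entry computable_reduce
  : computable.

Lemma computable_jet_matrix :
  computable (fun u => @jet_matrix k u.1 u.2.1 u.2.2).
Proof. by rewrite /jet_matrix; computable. Qed.

Lemma computable_branch : computable (@branch k).
Proof. by rewrite /branch; computable. Qed.
#[local] Hint Resolve computable_jet_matrix computable_branch : computable.

Lemma computable_pivots : computable (fun u => @pivots k u.1 u.2).
Proof. by rewrite /pivots; computable. Qed.
#[local] Hint Resolve computable_pivots : computable.

Lemma computable_strata : computable (fun u => @strata k u.1 u.2.1 u.2.2).
Proof. by rewrite /strata; computable. Qed.
#[local] Hint Resolve computable_strata : computable.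

(** One program serves all inputs: it searches until no sequence is left and then builds the strata.
    That a first empty round [i] exists is shown separately. *)
Theorem strata_program : exists p, forall n (gens : seq (upol k)) i,
  let st j := iter j (bad_step n.+1) (deg_bound gens, [:: [::]]) in
  (forall j, j < i -> ~~ nilp (st j).2) -> nilp (st i).2 ->
  run p (encode (n, gens)) (encode (strata n (st i).1 gens)).
Proof.
(* The loop state carries the input along, because [strata] needs it after the search. *)
pose T := ((nat * seq (upol k)) * (nat * seq (seq (seq nat))))%type.
pose test (u : T) := ~~ nilp u.2.2.
pose step (u : T) : T := (u.1, bad_step u.1.1.+1 u.2).
have [p1 Hp1] : computable (fun u : nat * seq (upol k) =>
    (u, (deg_bound u.2, [:: [::]])) : T) by computable.
have [p2 Hp2] : exists p, forall i a, (forall j, j < i ->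
  test (iter j step a)) ->
    ~~ test (iter i step a) -> run p (encode a) (encode (iter i step a)).
  by apply: computable_while; rewrite /test /step /nilp; computable.
have [p3 Hp3] : computable (fun u : T =>
  strata u.1.1 u.2.1 u.1.2) by computable.
exists (Seq p1 (Seq p2 p3)) => n gens i st st_n st_i.
pose a : T := ((n, gens), (deg_bound gens, [:: [::]])).
have iterE j : iter j step a = ((n, gens), st j) by elim: j => //= j ->.
apply: run_seq (Hp1 (n, gens)) _; apply: run_seq (Hp2 i a _ _) _.
- by move=> j lt_ji; rewrite iterE; exact: st_n.
- by rewrite iterE /test negbK.
by rewrite iterE; exact: Hp3.
Qed.

End ComputablePolynomials.

(** * Termination of the search *)

(** Move repeatedly to a position where [g] attains its minimum over the remaining tail. *)
Lemma exists_nondecreasing_subseq (g : nat -> nat) :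
  exists2 phi : nat -> nat, {homo phi : i j / i < j} &
    {homo g \o phi : i j / i <= j}.
Proof.
have ex_min m : exists p, m <= p /\ forall q, m <= q -> g p <= g q.
  have ex_v : exists v, `[< exists2 p, m <= p & g p = v >].
    by exists (g m); apply/asboolP; exists m.
  case: (ex_minnP ex_v) => v /asboolP[p le_mp <-] min_p.
  by exists p; split=> // q le_mq; apply: min_p; apply/asboolP; exists q.
have [P HP] := choice ex_min.
pose phi := fix phi i := if i is j.+1 then P (phi j).+1 else P 0.
have phi_min i q : phi i <= q -> g (phi i) <= g q.
  by case: i => [|i] /= le_q; [apply: (HP 0).2 | apply: (HP _).2;
    apply: leq_trans le_q; exact: (HP _).1].
have phiS i : phi i < phi i.+1 by exact: (HP _).1.
have phi_lt : {homo phi : i j / i < j} by apply: homo_ltn => //; exact: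
  ltn_trans.
exists phi => //= i j; rewrite leq_eqVlt => /predU1P[-> //|/phi_lt lt_ij].
exact/phi_min/ltnW.
Qed.

Lemma dickson N (f : nat -> nat -> nat) :
  exists i j, i < j /\ forall t, t < N -> f i t <= f j t.
Proof.
(* The induction on [N] needs a whole subsequence monotone in the first [N] coordinates; it is
   thinned out once more for each new coordinate. *)
suff [phi phi_lt phi_le] : exists2 phi : nat -> nat, {homo phi : i j / i < j} &
    forall t, t < N -> {homo (fun i => f (phi i) t) : i j / i <= j}.
  exists (phi 0), (phi 1); split=> [|t lt_tN]; first exact: phi_lt.
  exact: phi_le.
elim: N => [|N [phi phi_lt phi_le]]; first by exists id.
have [psi psi_lt psi_le] := exists_nondecreasing_subseq (fun i => f (phi i) N).
exists (phi \o psi) => [i j /psi_lt/phi_lt //|t].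
rewrite ltnS leq_eqVlt => /predU1P[->|lt_tN] i j; first exact: psi_le.
rewrite leq_eqVlt => /predU1P[-> //|/psi_lt/ltnW]; exact: phi_le.
Qed.

Lemma mem_box c N m : (m \in box c N) = (size m == N) && all (leq^~ c) m.
Proof.
elim: N m => [|N IHN] m; first by rewrite inE; case: m.
rewrite /box iterS -/(box c N); apply/allpairsP/idP => [[[x s] [+ + ->]]|].
  rewrite mem_iota IHN /= ltnS => -> /andP[/eqP <- ->].
  by rewrite eqxx.
case: m => // x s; rewrite [size _ == _]/= eqSS [all _ _]/= andbCA =>
  /andP[le_xc Hs].
by exists (x, s); rewrite mem_iota IHN /= ltnS le_xc Hs.
Qed.

Section Termination.
Variables (N c : nat).

Let B i := (iter i (bad_step N) (c, [:: [::]])).2.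
Let bad s := s \in B (size s).
Let C i := (iter i (bad_step N) (c, [:: [::]])).1.

Lemma bad_step_fst i : C i = c * 2 ^ i.
Proof. by elim: i => [|i IHi];
  rewrite ?muln1 // /C iterS /= -/(C i) IHi addnn -mul2n expnS mulnCA. Qed.

Lemma mem_bad_stepS i s : s \in B i.+1 ->
  exists m t, [/\ s = m :: t, t \in B i, m \in box (C i.+1) N &
    all (fun w => ~~ mon_le w m) t].
Proof.
rewrite /B iterS -/(C _) -/(B i) => /flattenP[l /mapP[t Ht ->] /mapP[m]].
by rewrite mem_filter => /andP[Hm Hb] ->; exists m, t.
Qed.

Lemma mem_bad_step i m t : t \in B i -> m \in box (C i.+1) N ->
  all (fun w => ~~ mon_le w m) t -> m :: t \in B i.+1.
Proof.
move=> Ht Hm Hb; rewrite /B iterS -/(B i); apply/flattenP.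
exists [seq m :: t | m <- [seq m <- box (C i.+1) N | all (fun w =>
  ~~ mon_le w m) t]].
  by apply/mapP; exists t.
by apply/map_f; rewrite mem_filter Hb.
Qed.

Lemma size_bad i s : s \in B i -> size s = i.
Proof.
elim: i s => [|i IHi] s; first by rewrite inE => /eqP ->.
by case/mem_bad_stepS => m [t [-> /IHi /= ->]].
Qed.

Let bad_cons m s : bad (m :: s) ->
  [/\ bad s, m \in box (C (size s).+1) N & all (fun w => ~~ mon_le w m) s].
Proof.
by case/mem_bad_stepS => m' [t [[-> ->] Ht Hm Hb]].
Qed.

Let bad_cat t s : bad (t ++ s) -> bad s.
Proof. by elim: t => //= m t IHt /bad_cons[/IHt]. Qed.

Theorem bad_step_terminates :
  exists i, nilp (iter i (bad_step N) (c, [:: [::]])).2.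
Proof.
apply: contrapT => /forallNP nonempty.
(* Koenig's lemma: [alive] nodes have bad extensions of every length. *)
pose alive s := forall k, exists2 t, size t = k & bad (t ++ s).
have alive0 : alive [::].
  move=> k; have /negP := nonempty k; rewrite -/(B k).
  case E: (B k) => [//|s l] _.
  have Hs : s \in B k by rewrite E mem_head.
  by exists s; rewrite ?cats0 /bad (size_bad Hs).
have aliveS s : alive s -> exists m, alive (m :: s).
  move=> Hs; apply: contrapT => /forallNP dead.
  have /choice[K HK] m : exists k, forall t, size t = k -> ~ bad (t ++ m :: s).
    have /existsNP[k Hk] := dead m; exists k => t Ht Hb.
    by apply: Hk; exists t.
  pose M := \max_(m <- box (C (size s).+1) N) K m.
  have [t] := Hs M.+1; case/lastP: t => // t m; rewrite size_rcons => -[szt].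
  rewrite cat_rcons => Hb.
  have le_KM : K m <= M.
    apply: leq_bigmax_seq => //.
    by case/bad_cons: (bad_cat Hb).
  (* Sequences are stored latest term first, so [m] comes right after [s] and dropping from the
     front of [t] keeps the terms nearest to [m]. *)
  apply: (HK m (drop (M - K m) t)); first by rewrite size_drop szt subKn.
  by apply: (@bad_cat (take (M - K m) t)); rewrite catA cat_take_drop.
have /choice[F HF] s : exists m, alive s -> alive (m :: s).
  by have [/aliveS[m Hm]|//] := pselect (alive s); [exists m | exists [::]].
pose S := fix S i := if i is j.+1 then F (S j) :: S j else [::].
have aliveSi i : alive (S i) by elim: i => //= i /HF.
have badS i : bad (S i) by have [t /size0nil ->] := aliveSi i 0.
have S_mem i j : i < j -> F (S i) \in S j.
  elim: j => // j IHj; rewrite ltnS leq_eqVlt inE => /predU1P[-> |/IHj ->].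
    by rewrite eqxx.
  by rewrite orbT.
(* Along the infinite branch Dickson's lemma yields a term dividing a later one, contrary to
   badness. *)
have [i [j [/S_mem Hij Hle]]] := dickson N (fun i => nth 0 (F (S i))).
have [_ _ /allP/(_ _ Hij)/negP[]] := bad_cons (badS j.+1).
apply/allP => t; rewrite mem_iota add0n /= => lt_t; apply: Hle.
have [_ + _] := bad_cons (badS i.+1).
by rewrite mem_box => /andP[/eqP <-].
Qed.

End Termination.

Local Open Scope ring_scope.

(** * Degrees of generators of the initial ideal *)

Inductive span (R : nzRingType) (V : lmodType R) (G : V -> Prop) : V -> Prop :=
| span0 : span G 0
| span_cons c g v : G g -> span G v -> span G (c *: g + v).

Section Span.
Variables (R : nzRingType) (V : lmodType R).
Implicit Types (G H : V -> Prop) (u v : V).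

Lemma span_gen G g : G g -> span G g.
Proof. by move=> Gg; rewrite -[g]addr0 -[g]scale1r; apply/span_cons/span0. Qed.

Lemma spanD G u v : span G u -> span G v -> span G (u + v).
Proof.
by elim=> [|c g w Gg _ IHw] Hv; rewrite ?add0r // -addrA; apply/span_cons/IHw.
Qed.

Lemma spanZ G a v : span G v -> span G (a *: v).
Proof.
elim=> [|c g w Gg _ IHw]; first by rewrite scaler0; exact: span0.
by rewrite scalerDr scalerA; exact: span_cons.
Qed.

Lemma spanB G u v : span G u -> span G v -> span G (u - v).
Proof. by move=> Hu Hv; rewrite -scaleN1r; apply: spanD Hu (spanZ _ Hv). Qed.

End Span.

Lemma span_linear (R : nzRingType) (V W : lmodType R) (f : {linear V ->
  W}) (G : V -> Prop) (H : W -> Prop) v :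
  (forall g, G g -> span H (f g)) -> span G v -> span H (f v).
Proof.
move=> GH; elim=> [|c g w Gg _ IHw]; first by rewrite linear0; exact: span0.
by rewrite linearP; apply: spanD IHw; apply/spanZ/GH.
Qed.

Lemma sub_span (R : nzRingType) (V : lmodType R) (G H : V -> Prop) v :
  (forall g, G g -> span H g) -> span G v -> span H v.
Proof. exact: (span_linear (f := idfun)). Qed.

(** * Initial monomials *)

Section MonomialOrder.
Variables (K : fieldType) (n : nat).
Implicit Types (g h : {mpoly K[n]}) (u m b : 'X_{1..n}).

Lemma mcoeff_mlast_neq0 g : g != 0 -> g@_(mlast g) != 0.
Proof. by move=> /mlast_supp; rewrite mcoeff_msupp. Qed.

Lemma mlast_gt g b : g != 0 -> (forall m, (m <= b)%O -> g@_m = 0) ->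
  (b < mlast g)%O.
Proof.
move=> g0 Hg; rewrite ltNge; apply/negP => /Hg/eqP.
by apply/negP/mcoeff_mlast_neq0.
Qed.

Lemma mulX_neq0 h u : h != 0 -> h * 'X_[u] != 0.
Proof.
move/mcoeff_mlast_neq0/eqP => h0; apply/eqP => E; apply: h0.
by rewrite -(mcoeffMX h u) E mcoeff0.
Qed.

Lemma mlastMX h u : h != 0 -> mlast (h * 'X_[u]) = (u + mlast h)%MM.
Proof.
move=> h0; apply: mlastE => [|m].
  by rewrite mcoeff_msupp mcoeffMX mcoeff_mlast_neq0.
rewrite (perm_mem (msuppMX _ _)) => /mapP[m' Hm' ->].
by rewrite lemc_add2r mlast_lemc.
Qed.

(** Only finitely many monomials above [b] have degree at most [e]. Cancelling the smallest term of
    a polynomial moves upwards in the order, so reductions terminate by this induction. *)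
Lemma mon_up_ind e (Q : 'X_{1..n} -> Prop) :
  (forall b, (forall b', (b < b')%O -> (mdeg b' <= e)%N -> Q b') -> Q b) ->
  forall b, Q b.
Proof.
move=> IH b; pose above b := [set m : 'X_{1..n < e.+1} | (b < m)%O].
have [N] := ubnP #|above b|; elim: N b => // N IHN b; rewrite ltnS => le_bN.
apply: IH => b' lt_bb' le_b'e; apply: IHN; apply: leq_trans le_bN.
apply/proper_card/properP; split.
  by apply/subsetP => m; rewrite !inE; apply: lt_trans.
have lt_b'e : (mdeg b' < e.+1)%N by [].
by exists (BMultinom lt_b'e); rewrite inE //= ltxx.
Qed.

End MonomialOrder.

(** * Buchberger's criterion for the filtered ideal *)

Section Filtration.
Variables (K : fieldType) (n d D : nat) (F : seq {mpoly K[n]}).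
Hypothesis F_deg : forall f m, f \in F -> m \in msupp f -> (mdeg m <= d)%N.
Implicit Types (g h : {mpoly K[n]}) (u m b w : 'X_{1..n}).

Definition filt e : {mpoly K[n]} -> Prop :=
  span (fun g => exists f u, [/\ f \in F,
    (d + mdeg u <= e)%N & g = f * 'X_[u]]).

Definition initial e b : Prop := exists g, [/\ filt e g, g != 0 & mlast g = b].

(* Divisibility of [t^(e - |b|) y^b] by [t^(e' - |w|) y^w]. *)
Definition divided e b : Prop := exists e' w,
  [/\ (e' <= D)%N, initial e' w, (w <= b)%MM & (e' + mdeg b <= e + mdeg w)%N].

Lemma filt_le e e' g : (e <= e')%N -> filt e g -> filt e' g.
Proof.
move=> le_ee'; apply: sub_span => _ [f [u [Ff le_e ->]]]; apply: span_gen.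
by exists f, u; split=> //; apply: leq_trans le_ee'.
Qed.

Lemma filt_mulX e u g : filt e g -> filt (e + mdeg u) (g * 'X_[u]).
Proof.
apply: (span_linear (f := 'X_[u] \o* idfun)) => _ [f [v [Ff le_e ->]]] /=.
apply: span_gen; exists f, (v + u)%MM; split=> //; last first.
  by rewrite /= -mulrA -mpolyXD.
by rewrite mdegD addnA leq_add2r.
Qed.

Lemma filt_mdeg e g m : filt e g -> m \in msupp g -> (mdeg m <= e)%N.
Proof.
move=> Hg; apply: contraTT; rewrite -ltnNge -mcoeff_eq0 => lt_em; apply/eqP.
elim: Hg => [|c _ v [f [u [Ff le_e ->]]] _ IHv]; first by rewrite mcoeff0.
rewrite mcoeffD mcoeffZ IHv addr0; apply/eqP; rewrite mulf_eq0 orbC.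
rewrite mcoeff_eq0 (perm_mem (msuppMX _ _)).
apply/orP; left; apply: contraTN lt_em => /mapP[m' /(F_deg Ff) le_d ->].
by rewrite -leqNgt mdegD addnC; apply: leq_trans le_e; rewrite leq_add2r.
Qed.

(** With [P] a lower bound on initial monomials, these are the standard representations of
    Buchberger's criterion; keeping track of the filtration degree amounts to homogenising. *)
Definition std e (P : 'X_{1..n} -> Prop) : {mpoly K[n]} -> Prop :=
  span (fun g => exists e' u h, [/\ (e' <= D)%N, filt e' h, h != 0,
    (e' + mdeg u <= e)%N & P (u + mlast h)%MM /\ g = h * 'X_[u]]).

Lemma sub_std e P Q g : (forall m, P m -> Q m) -> std e P g -> std e Q g.
Proof.
move=> PQ; apply: sub_span => _ [e' [u [h [? ? ? ? [/PQ ? ->]]]]].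
by apply: span_gen; exists e', u, h.
Qed.

Lemma std_le e e' P g : (e <= e')%N -> std e P g -> std e' P g.
Proof.
move=> le_ee'; apply: sub_span => _ [e1 [u [h [? ? ? le_e [? ->]]]]].
by apply: span_gen; exists e1, u, h; split=> //; apply: leq_trans le_ee'.
Qed.

Lemma std_mulX e (P Q : 'X_{1..n} -> Prop) v g :
  (forall m, P m -> Q (v + m)%MM) -> std e P g ->
  std (e + mdeg v) Q (g * 'X_[v]).
Proof.
move=> PQ.
apply: (span_linear (f := 'X_[v] \o* idfun)) =>
  _ [e' [u [h [? ? ? ? [/PQ ? ->]]]]] /=.
apply: span_gen; exists e', (v + u)%MM, h; split=> //.
  by rewrite mdegD addnCA addnC leq_add2r.
by rewrite -addmA; split=> //; rewrite /= -mulrA -mpolyXD addmC.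
Qed.

Lemma std_coef_lt e b g m : std e (fun m' => (b < m')%O) g -> (m <= b)%O ->
  g@_m = 0.
Proof.
move=> Hg le_mb; elim: Hg => [|c _ v [e' [u [h [_ _ h0 _ [lt_b ->]]]]] _ IHv].
  by rewrite mcoeff0.
rewrite mcoeffD mcoeffZ IHv addr0 mcoeff_lt_mlast ?mulr0 // mlastMX //.
exact: le_lt_trans lt_b.
Qed.

(** The bound is twice [D] because an S-polynomial of two elements of filtration degree at most [D]
    has filtration degree at most [D + D]. *)
Definition stable : Prop :=
  forall e b, (e <= D + D)%N -> initial e b -> divided e b.

Hypothesis D_stable : stable.

(** This is the division algorithm: stability provides a multiple that cancels the initial term, and
    the remainder has a larger initial monomial. *)
Lemma std_of_filt e g : (e <= D + D)%N -> filt e g -> g != 0 ->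
  std e (fun m => (mlast g <= m)%O) g.
Proof.
move=> le_eD; move: {2}(mlast g) (erefl (mlast g)) => b; move: b g.
apply: (mon_up_ind (e := e)) => b IHb g Eb Hg g0.
have [e' [w [le_e' [h [Hh h0 Ew]] le_wb le_e]]] : divided e b.
  by apply: D_stable => //; exists g.
pose u := (b - w)%MM; have Eub : (u + w)%MM = b by rewrite submK.
have le_ue : (e' + mdeg u <= e)%N.
  by move: le_e; rewrite -Eub mdegD addnA leq_add2r.
pose c := g@_b / h@_w; pose g' := g - c *: (h * 'X_[u]).
suff : std e (fun m => (mlast g <= m)%O) (c *: (h * 'X_[u]) + g').
  by rewrite addrC subrK.
have hw0 : h@_w != 0 by rewrite -Ew mcoeff_mlast_neq0.
have Hg' : filt e g'.
  apply: spanB => //; apply/spanZ/(filt_le le_ue)/filt_mulX => //.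
apply: span_cons.
  by exists e', u, h; rewrite Ew Eub Eb lexx.
have [->|g'0] := eqVneq g' 0; first exact: span0.
have lt_b : (b < mlast g')%O.
  apply: mlast_gt => // m; rewrite le_eqVlt => /predU1P[->|lt_mb].
    by rewrite mcoeffB mcoeffZ -{2}Eub mcoeffMX /c divfK ?subrr.
  rewrite mcoeffB mcoeffZ !mcoeff_lt_mlast ?mulr0 ?subr0 ?Eb //.
  by rewrite mlastMX // Ew Eub.
have Hstd := IHb _ lt_b (filt_mdeg Hg' (mlast_supp g'0)) g' erefl Hg' g'0.
apply: (@sub_std e _ (fun m => (mlast g <= m)%O)) Hstd => m; rewrite Eb; apply:
  le_trans; exact: ltW.
Qed.

(** The difference is a multiple of the S-polynomial formed at the least common multiple [z], and
    [std_of_filt] applies to that S-polynomial. *)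
Lemma std_spair e b e1 u1 h1 e2 u2 h2 :
  [/\ (e1 <= D)%N, filt e1 h1, h1 != 0, (e1 + mdeg u1 <= e)%N &
      (u1 + mlast h1)%MM = b] ->
  [/\ (e2 <= D)%N, filt e2 h2, h2 != 0, (e2 + mdeg u2 <= e)%N &
      (u2 + mlast h2)%MM = b] ->
  exists c, std e (fun m => (b < m)%O) (h1 * 'X_[u1] - c *: (h2 * 'X_[u2])).
Proof.
set w1 := mlast h1; set w2 := mlast h2.
move=> [le_e1 Hh1 h10 le_u1 Eb1] [le_e2 Hh2 h20 le_u2 Eb2].
pose z := mlcm w1 w2; pose v := (b - z)%MM.
have le_w1b : (w1 <= b)%MM by rewrite -Eb1 lem_addl.
have le_w2b : (w2 <= b)%MM by rewrite -Eb2 lem_addl.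
have Evb : (v + z)%MM = b by rewrite submK // lem_mlcm le_w1b.
have le_w1z : (w1 <= z)%MM by exact: lem_mlcml.
have le_w2z : (w2 <= z)%MM by exact: lem_mlcmr.
pose t1 := (z - w1)%MM; pose t2 := (z - w2)%MM.
have Et1 : (t1 + w1)%MM = z by rewrite submK.
have Et2 : (t2 + w2)%MM = z by rewrite submK.
have Eu1 : u1 = (v + t1)%MM by apply: (@addIm _ w1); rewrite -addmA Et1 Evb.
have Eu2 : u2 = (v + t2)%MM by apply: (@addIm _ w2); rewrite -addmA Et2 Evb.
pose e0 := maxn (e1 + mdeg t1) (e2 + mdeg t2).
have le_w1 : (mdeg w1 <= e1)%N by apply: filt_mdeg Hh1 (mlast_supp h10).
have le_w2 : (mdeg w2 <= e2)%N by apply: filt_mdeg Hh2 (mlast_supp h20).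
(* Here [t1] is the truncated difference [w2 - w1]; since the degree of [w2] is at most [e2], the
   S-polynomial stays within degree [D + D]. *)
have le_t1 : (mdeg t1 <= mdeg w2)%N.
  by rewrite /t1 /z mlcmE addmC addmK mdegB.
have le_t2 : (mdeg t2 <= mdeg w1)%N.
  by rewrite /t2 /z mlcmC mlcmE addmC addmK mdegB.
have le_e0 : (e0 <= D + D)%N by rewrite /e0; lia.
have h2w : h2@_w2 != 0 by rewrite mcoeff_mlast_neq0.
pose c := h1@_w1 / h2@_w2; exists c.
pose s := h1 * 'X_[t1] - c *: (h2 * 'X_[t2]).
have -> : h1 * 'X_[u1] - c *: (h2 * 'X_[u2]) = s * 'X_[v].
  by rewrite mulrBl -scalerAl -!mulrA -!mpolyXD Eu1 Eu2 ![(v + _)%MM]addmC.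
have Hs : filt e0 s.
  apply: spanB; last apply: spanZ.
    by apply: filt_le (filt_mulX _ Hh1); rewrite leq_maxl.
  by apply: filt_le (filt_mulX _ Hh2); rewrite leq_maxr.
have le_e0e : (e0 + mdeg v <= e)%N.
  by move: le_u1 le_u2; rewrite Eu1 Eu2 !mdegD /e0; lia.
apply: std_le le_e0e _.
apply: (@std_mulX _ (fun m => (z < m)%O)) => [m|].
  by rewrite -Evb ltmc_add2r.
have [->|s0] := eqVneq s 0; first exact: span0.
apply: sub_std (std_of_filt le_e0 Hs s0) => m; apply: lt_le_trans.
apply: mlast_gt => // m'; rewrite le_eqVlt => /predU1P[->|lt_mz].
  by rewrite mcoeffB mcoeffZ -{1}Et1 -Et2 !mcoeffMX /c divfK ?subrr.
rewrite mcoeffB mcoeffZ !mcoeff_lt_mlast ?mulr0 ?subr0 //.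
  by rewrite mlastMX // -/w2 Et2.
by rewrite mlastMX // -/w1 Et1.
Qed.

(** By [std_spair] all terms with initial monomial [b] can be merged into a multiple of a single
    one. *)
Lemma std_split e b g : std e (fun m => (b <= m)%O) g ->
  std e (fun m => (b < m)%O) g \/
  exists c e0 u0 h0, [/\ (e0 <= D)%N, filt e0 h0, h0 != 0,
      (e0 + mdeg u0 <= e)%N & (u0 + mlast h0)%MM = b] /\
    std e (fun m => (b < m)%O) (g - c *: (h0 * 'X_[u0])).
Proof.
elim=> [|c1 _ g1 [e1 [u1 [h1 [le_e1 Hh1 h10 le_u1 [+ ->]]]]] _].
  by left; exact: span0.
rewrite le_eqVlt => /predU1P[Eb|lt_b] [Hg1|[c [e0 [u0 [h0 [H0 Hg1]]]]]].
- right; exists c1, e1, u1, h1; split; last by rewrite addrAC subrr add0r.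
  by split.
- have [|a Ha] := @std_spair e b e1 u1 h1 e0 u0 h0 _ H0; first by split.
  right; exists (c + c1 * a), e0, u0, h0; split=> //.
  suff -> : c1 *: (h1 * 'X_[u1]) + g1 - (c + c1 * a) *: (h0 * 'X_[u0]) =
     c1 *: (h1 * 'X_[u1] - a *: (h0 * 'X_[u0])) + (g1 - c *: (h0 * 'X_[u0])).
    by apply: spanD => //; apply: spanZ.
  by rewrite scalerDl scalerBr scalerA [c *: _ + _]addrC opprD addrACA.
- by left; apply: span_cons => //; exists e1, u1, h1.
- right; exists c, e0, u0, h0; split=> //; rewrite -addrA.
  by apply: span_cons => //; exists e1, u1, h1.
Qed.

(** A representation has finitely many terms, and [b'] is the least of their initial monomials. Its
    degree bound is what [mon_up_ind] requires. *)
Lemma std_gt_step e b g : std e (fun m => (b < m)%O) g ->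
  g = 0 \/ exists2 b', (b < b')%O /\ (mdeg b' <= e)%N &
                       std e (fun m => (b' <= m)%O) g.
Proof.
elim=> [|c1 _ g1 [e1 [u1 [h1 [le_e1 Hh1 h10 le_u1 [lt_b ->]]]]] _];
  first by left.
have le_deg : (mdeg (u1 + mlast h1) <= e)%N.
  rewrite mdegD addnC; apply: leq_trans le_u1; rewrite leq_add2r.
  exact: filt_mdeg Hh1 (mlast_supp h10).
move=> IH; right.
have [b' [Hb' Hle Hg1]] : exists b', [/\ (b < b')%O /\ (mdeg b' <= e)%N,
   (b' <= (u1 + mlast h1)%MM)%O & std e (fun m => (b' <= m)%O) g1].
  case: IH => [->|[b' [lt_b' le_b'] Hg1]].
    by exists (u1 + mlast h1)%MM; split=> //; exact: span0.
  have [le|/ltW le] := leP b' (u1 + mlast h1)%MM; first by exists b'.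
  exists (u1 + mlast h1)%MM; split=> //.
  by apply: sub_std Hg1 => m; apply: le_trans.
by exists b' => //; apply: span_cons => //; exists e1, u1, h1.
Qed.

(** If the terms at [b] cancel, the lower bound can be raised. Otherwise one term at [b] survives,
    and its initial monomial is that of [g]. *)
Lemma std_divided e b g : std e (fun m => (b <= m)%O) g -> g != 0 ->
  divided e (mlast g).
Proof.
move: b g; apply: (mon_up_ind (e := e)) => b IHb g Hg g0.
have gt_case : std e (fun m => (b < m)%O) g -> divided e (mlast g).
  by case/std_gt_step => [/eqP/(negP g0)//|[b' [lt_b' le_b'] Hb']]; exact:
    IHb Hb' _.
case: (std_split Hg) => [//|[c [e0 [u0 [h0 [[le_e0 Hh0 h00 le_u0 Eb] Hg']]]]]].
have [c0|c0] := eqVneq c 0; first by apply: gt_case;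
  rewrite c0 scale0r subr0 in Hg'.
have Elast : mlast g = b.
  apply: mlastE => [|m].
    have /eqP := std_coef_lt Hg' (lexx _).
    rewrite mcoeffB mcoeffZ -{2}Eb mcoeffMX subr_eq0 mcoeff_msupp => /eqP ->.
    by rewrite mulf_neq0 ?mcoeff_mlast_neq0.
  rewrite mcoeff_msupp leNgt; apply: contraNN => lt_mb.
  have := std_coef_lt Hg' (ltW lt_mb).
  rewrite mcoeffB mcoeffZ [(h0 * _)@_m]mcoeff_lt_mlast ?mlastMX ?Eb //.
  by rewrite mulr0 subr0 => ->.
exists e0, (mlast h0); rewrite Elast; split=> //; first by exists h0.
  by rewrite -Eb lem_addl.
by rewrite -Eb mdegD addnA leq_add2r.
Qed.

Theorem stable_divided e b : (d <= D)%N -> initial e b -> divided e b.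
Proof.
move=> le_dD [g [Hg g0 <-]]; apply: (@std_divided _ 0%MM) => //.
(* Each [f * 'X_[u]] is a standard term by itself, as [f] has filtration degree [d], at most [D];
   the lower bound [0%MM] is vacuous. *)
apply: sub_span Hg => _ [f [u [Ff le_e ->]]].
have [->|f0] := eqVneq f 0; first by rewrite mul0r; exact: span0.
apply: span_gen; exists d, u, f; split=> //; last by rewrite le0x.
apply: span_gen; exists f, 0%MM; rewrite mdeg0 addn0; split=> //.
by rewrite mpolyX0 mulr1.
Qed.

End Filtration.

(** * From the search to a degree bound *)

Section DegreeBound.
Variables (K : fieldType) (n d : nat) (F : seq {mpoly K[n]}).
Hypothesis F_deg : forall f m, f \in F -> m \in msupp f -> (mdeg m <= d)%N.

(* The exponents of the monomial of degree [e] obtained from [b] by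
   homogenising with an extra variable. *)
Let hom e (b : 'X_{1..n}) : seq nat := (e - mdeg b)%N :: b.

Let le_hom e e' (b b' : 'X_{1..n}) :
  (mdeg b <= e)%N -> (mdeg b' <= e')%N -> mon_le (hom e b) (hom e' b') ->
  (b <= b')%MM /\ (e + mdeg b' <= e' + mdeg b)%N.
Proof.
move=> le_be le_be'; rewrite /mon_le /= size_tuple => /andP[le0 /allP le_b].
split; last by lia.
apply/mnm_lepP => i; have := le_b i.+1; rewrite mem_iota /= !(mnm_nth 0).
by apply; rewrite ltnS ltn_ord.
Qed.

Variable c : nat.
Let st i := iter i (bad_step n.+1) (c, [:: [::]]).

(** An unstable round has an undivided pair [(e, b)] of degree at most twice the current bound; its
    homogenised exponents are divisible by no earlier term and prolong the sequence. *)
Let bad_of_unstable i :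
  (forall j, (j < i)%N -> ~ stable d (st j).1 F) ->
  exists2 s, s \in (st i).2 & forall m, m \in s ->
    exists e b, [/\ m = hom e b, (e <= (st i).1)%N & initial d F e b].
Proof.
elim: i => [|i IHi] unst; first by exists [::].
have [|s Hs Hm] := IHi; first by move=> j lt_ji; apply/unst/ltnW.
have [e [b [le_e Hb Hdiv]]] : exists e b, [/\ (e <= (st i).1 + (st i).1)%N,
    initial d F e b & ~ divided d (st i).1 F e b].
  apply: contrapT => H; apply: (unst i) => // e b le_e Hb.
  by apply: contrapT => Hdiv; apply: H; exists e, b.
have le_be : (mdeg b <= e)%N.
  by case: Hb => g [Hg g0 <-]; apply: filt_mdeg Hg (mlast_supp g0).
exists (hom e b :: s).
  apply: mem_bad_step => //.
    rewrite mem_box /= size_tuple eqxx /=; apply/andP; split.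
      by apply: leq_trans le_e; exact: leq_subr.
    apply/allP => x /tnthP[j ->]; apply: leq_trans le_e.
    apply: leq_trans le_be; rewrite mdegE (bigD1 j) //= leq_addr //.
  apply/allP => _ /Hm[e' [b' [-> le_e' Hb']]]; apply/negP => le_hb.
  have le_be' : (mdeg b' <= e')%N.
    by case: Hb' => g [Hg g0 <-]; apply: filt_mdeg Hg (mlast_supp g0).
  by have [? ?] := le_hom le_be' le_be le_hb; apply: Hdiv; exists e', b'.
move=> m; rewrite inE => /predU1P[->|/Hm[e' [b' [-> le_e' Hb']]]].
  by exists e, b.
by exists e', b'; split=> //; apply: leq_trans le_e' _;
  rewrite /st iterS leq_addr.
Qed.

(** Since round [i] is empty, some earlier round [j] is stable. This [j] depends on [F], hence on
    the point, but the bound [(st i).1] does not. *)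
Lemma initial_degree_bound i : (d <= c)%N -> nilp (st i).2 ->
  forall e b, initial d F e b -> exists e' w,
    [/\ (mdeg w <= (st i).1)%N, initial d F e' w & (w <= b)%MM].
Proof.
move=> le_dc /nilP nil_i e b Hb.
have C_le j j' : (j <= j')%N -> ((st j).1 <= (st j').1)%N.
  by move=> le_j; rewrite !bad_step_fst leq_mul2l leq_exp2l // le_j orbT.
have [j [lt_ji /(stable_divided F_deg)]] :
    exists j, (j < i)%N /\ stable d (st j).1 F.
  apply: contrapT => H; have [|s] := @bad_of_unstable i; last by rewrite nil_i.
  by move=> j lt_ji Hst; apply: H; exists j.
case/(_ e b (leq_trans le_dc (C_le 0%N j isT)) Hb) => e' [w [le_e' Hw le_wb _]].
exists e', w; split=> //; apply: leq_trans (C_le j i (ltnW lt_ji)).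
apply: leq_trans le_e'.
by case: Hw => g [Hg g0 <-]; apply: filt_mdeg Hg (mlast_supp g0).
Qed.

End DegreeBound.

(** * The Hilbert-Samuel function *)

Section SeriesIdeals.
Variables (K : fieldType) (n : nat).
Implicit Types (f g v : fps K n) (p q : {mpoly K[n]}) (m : 'X_{1..n}).

Definition fps_of p : fps K n := fun m => p@_m.

Definition fps_trunc r f : {mpoly K[n]} :=
  \sum_(m : 'X_{1..n < r}) f m *: 'X_[m].

Lemma fps_truncE r f m : (mdeg m < r)%N -> (fps_trunc r f)@_m = f m.
Proof. by move=> lt_mr; rewrite mcoeff_mpoly. Qed.

Lemma fps_addE f g m : (f + g) m = f m + g m. Proof. by []. Qed.

Lemma fps_oppE f m : (- f) m = - f m. Proof. by []. Qed.

Lemma fps_scaleE c f m : (c *: f) m = c * f m. Proof. by []. Qed.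

Lemma fps_sumE (I : Type) (r : seq I) (P : pred I) (F : I -> fps K n) m :
  (\sum_(i <- r | P i) F i) m = \sum_(i <- r | P i) F i m.
Proof. by elim/big_rec2: _ => // i y x _ <-. Qed.

Lemma fps_ofM p q : fps_of (p * q) = fps_of p * fps_of q.
Proof. by apply/funext => m; rewrite /fps_of mcoeffM. Qed.

Lemma fps_ofD p q : fps_of (p + q) = fps_of p + fps_of q.
Proof. by apply/funext => m; rewrite /fps_of mcoeffD. Qed.

Lemma fps_mul_congr f f' g g' m :
  (forall l, (mdeg l <= mdeg m)%N -> f l = f' l) ->
  (forall l, (mdeg l <= mdeg m)%N -> g l = g' l) -> (f * g) m = (f' * g') m.
Proof.
move=> Hf Hg; apply: eq_bigr => -[l1 l2] _ /=.
by rewrite Hf ?Hg // -ltnS bmdeg.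
Qed.

Lemma fps_mul_trunc_l r f p m : (mdeg m < r)%N ->
  (f * fps_of p) m = (fps_trunc r f * p)@_m.
Proof.
move=> lt_mr; rewrite -/(fps_of _ m) fps_ofM; apply: fps_mul_congr =>
  // l le_lm.
by rewrite /fps_of fps_truncE //; apply: leq_ltn_trans lt_mr.
Qed.

Lemma fps_mul_ord_l r f g : (forall m, (mdeg m < r)%N -> g m = 0) ->
  forall m, (mdeg m < r)%N -> (f * g) m = 0.
Proof.
move=> Hg m lt_mr.
have -> : (f * g) m = (f * 0) m; last by rewrite mulr0.
by apply: fps_mul_congr => // l le_lm; rewrite Hg //; apply:
  leq_ltn_trans lt_mr.
Qed.

(** These are the terms of [f] whose first variable is ['X_i], divided by ['X_i]; every nonconstant
    term thus goes to exactly one [i]. *)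
Definition fps_var_part (i : 'I_n) f : fps K n := fun m =>
  if [forall j : 'I_n, (j < i)%N ==> (m j == 0%N)] then f (m + U_(i))%MM else 0.

Lemma fps_mulX (i : 'I_n) f m :
  (fps_of 'X_i * f) m = if (0 < m i)%N then f (m - U_(i))%MM else 0.
Proof.
rewrite mulrC (@fps_mul_trunc_l (mdeg m).+1) //.
case: ifPn => [m_gt0|].
  have le_im : (U_(i) <= m)%MM by rewrite lep1mP -lt0n.
  rewrite -{1}(submK le_im) addmC mcoeffMX fps_truncE //.
  by rewrite ltnS mdegB.
rewrite -eqn0Ngt => mi0; apply/eqP; rewrite mcoeff_eq0 (perm_mem (msuppMX _ _)).
apply: contraL mi0 => /mapP[m' _ ->].
by rewrite mnmDE mnm1E eqxx.
Qed.

Lemma fps_var_partE f : f 0%MM = 0 ->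
  f = \sum_i fps_of 'X_i * fps_var_part i f.
Proof.
move=> f0; apply/funext => m; rewrite fps_sumE.
under eq_bigr do rewrite fps_mulX /fps_var_part.
have [m0|m_neq0] := eqVneq m 0%MM.
  by rewrite m0 f0 big1 // => i _; rewrite mnmE.
have [i0 Hi0] : exists i, (0 < m i)%N.
  apply/existsP; apply: contraNT m_neq0; rewrite negb_exists => /forallP H.
  by apply/eqP/mnmP => i; rewrite mnmE; apply/eqP; rewrite eqn0Ngt.
have [i Hi min_i] := @arg_minnP _ i0 (fun i => 0 < m i)%N val Hi0.
rewrite (bigD1 i) //= Hi big1 ?addr0.
  case: ifPn => [_|/negP[]]; first by rewrite submK // lep1mP -lt0n.
  apply/forallP => j; apply/implyP => lt_ji; rewrite mnmBE.
  have [/min_i|] := ltnP 0 (m j); first by rewrite leqNgt lt_ji.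
  by rewrite leqn0 => /eqP ->.
move=> j neq_ji; case: ifP => // Hj; case: ifP => // /forallP/(_ i).
have lt_ij : (i < j)%N by rewrite ltn_neqAle eq_sym neq_ji; exact: min_i.
rewrite lt_ij mnmBE mnm1E (negbTE neq_ji) subn0 /= => /eqP E.
by move: Hi; rewrite E.
Qed.

Lemma ideal_gen_sum (A : fps K n -> Prop) (I : finType) (F : I -> fps K n) :
  (forall i, A (F i)) -> ideal_gen A (\sum_i F i).
Proof.
move=> AF; exists [seq (1, F i) | i <- index_enum I].
  by move=> p /mapP[i _ ->]; exact: AF.
by rewrite big_map; apply: eq_bigr => i _; rewrite mul1r.
Qed.

(** Orders add up under products. Conversely, [fps_var_partE] splits a series of order [r.+1] into
    variables times series of order [r]. *)
Lemma ideal_pow_max r v : ideal_pow (@fps_max_ideal K n) r v <->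
  forall m, (mdeg m < r)%N -> v m = 0.
Proof.
elim: r v => [|r IHr] v /=; first by split.
split=> [[s Hs ->] m lt_mr|Hv].
  rewrite fps_sumE big1_seq // => -[a bc] /= /Hs[b [c [b0 /IHr Hc /= ->]]].
  apply: fps_mul_ord_l lt_mr => {}m lt_mr.
  rewrite [LHS]big1 // => -[k1 k2] /= /eqP Em.
  have [k10|k1_neq0] := eqVneq (k1 : 'X_{1..n}) 0%MM;
    first by rewrite k10 b0 mul0r.
  rewrite Hc ?mulr0 //; move/(congr1 mdeg): Em; rewrite mdegD => Edeg.
  move: lt_mr; rewrite [X in (X < _)%N]Edeg ltnS.
  by apply: leq_trans; rewrite -[X in (X <= _)%N]add1n leq_add2r lt0n mdeg_eq0.
rewrite (fps_var_partE (Hv 0%MM _)) ?mdeg0 //; apply: ideal_gen_sum => i.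
exists (fps_of 'X_i), (fps_var_part i v); split=> //.
  rewrite /fps_max_ideal /fps_of mcoeffX.
  by rewrite -mdeg_eq0 mdeg1.
apply/IHr => m lt_mr; rewrite /fps_var_part; case: ifP => // _.
by rewrite Hv // mdegD mdeg1 addn1.
Qed.

End SeriesIdeals.

(** * Standard monomials as a basis of the local quotient *)

Section HilbertFunction.
Variables (k K : fieldType) (iota : {rmorphism k -> K}) (n : nat).
Variables (gens : seq (pol k n)) (x0 : 'I_n -> K).
Implicit Types (g h p : {mpoly K[n]}) (m b u : 'X_{1..n}) (v : fps K n).

Definition translate (p : {mpoly k[n]}) : {mpoly K[n]} :=
  map_mpoly iota p \mPo [tuple ('X_i + (x0 i)%:MP : {mpoly K[n]}) | i < n].

Definition translated_gens : seq {mpoly K[n]} :=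
  [seq translate (mpoly_of_pol s) | s <- gens].

Definition translated_ideal : {mpoly K[n]} -> Prop :=
  span (fun g => exists f u, f \in translated_gens /\ g = f * 'X_[u]).

(** This is the set [L(x0)]. Polynomials suffice here, because the quotients only involve
    truncations of series. *)
Definition initial_ideal b : Prop :=
  exists g, [/\ translated_ideal g, g != 0 & mlast g = b].

Lemma translateD (p q : {mpoly k[n]}) :
  translate (p + q) = translate p + translate q.
Proof. by rewrite /translate !rmorphD. Qed.

Lemma translateM (p q : {mpoly k[n]}) :
  translate (p * q) = translate p * translate q.
Proof. by rewrite /translate !rmorphM. Qed.

Lemma translate_sum (I : Type) (r : seq I) (F : I -> {mpoly k[n]}) :
  translate (\sum_(i <- r) F i) = \sum_(i <- r) translate (F i).
Proof.
elim: r => [|i r IHr]; first by rewrite !big_nil /translate !rmorph0.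
by rewrite !big_cons translateD IHr.
Qed.

(** The filtration exhausts the ideal, whatever the offset [d]. *)
Lemma initial_idealE d b : initial_ideal b <->
  exists e, initial d translated_gens e b.
Proof.
split=> [[g [Hg g0 Eb]]|[e [g [Hg g0 Eb]]]]; last first.
  exists g; split=> //; apply: sub_span Hg => _ [f [u [Hf _ ->]]].
  by apply: span_gen; exists f, u.
suff [e He] : exists e, filt d translated_gens e g by exists e, g.
elim: Hg => [|c _ g1 [f [u [Ff ->]]] _ [e He]]; first by exists 0%N; exact:
  span0.
exists (e + (d + mdeg u))%N; apply: span_cons.
  by exists f, u; split=> //; rewrite leq_addl.
by apply: filt_le He; rewrite leq_addr.
Qed.

Lemma translated_idealM g p : translated_ideal g -> translated_ideal (g * p).
Proof.
move=> Hg; rewrite (mpolyE p) mulr_sumr.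
elim: (msupp p) => [|m s IHs]; first by rewrite big_nil; exact: span0.
rewrite big_cons; apply: spanD IHs; rewrite -scalerAr; apply: spanZ.
apply: (span_linear (f := 'X_[m] \o* idfun)) Hg => _ [f [u [Ff ->]]] /=.
by apply: span_gen; exists f, (u + m)%MM; rewrite mpolyXD mulrA.
Qed.

Lemma translate_in_ideal (p : {mpoly k[n]}) : ideal_of_pols gens p ->
  translated_ideal (translate p).
Proof.
case=> s Hs ->; rewrite translate_sum.
elim: s Hs => [|t s IHs] Hs; first by rewrite big_nil; exact: span0.
rewrite big_cons; apply: spanD; last first.
  by apply: IHs => q Hq; apply: Hs; rewrite inE Hq orbT.
rewrite translateM mulrC; apply: translated_idealM.
have [f Hf ->] := Hs t (mem_head _ _); apply: span_gen.
exists (translate (mpoly_of_pol f)), 0%MM; split; last by rewrite mpolyX0 mulr1.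
exact: map_f.
Qed.

(** Below degree [r] the series coefficients of a combination may be replaced by their truncations,
    which leaves an element of the polynomial ideal. *)
Lemma extended_idealP r v :
  ideal_add (extended_ideal iota (ideal_of_pols gens) x0)
    (ideal_pow (@fps_max_ideal K n) r) v <->
  exists2 g, translated_ideal g & forall m, (mdeg m < r)%N -> v m = g@_m.
Proof.
split=> [[_ [c [[s Hs ->] /ideal_pow_max Hc ->]]]|[g Hg Hv]].
  suff [g Hg E] : exists2 g, translated_ideal g &
      forall m, (mdeg m < r)%N -> (\sum_(p <- s) p.1 * p.2) m = g@_m.
    by exists g => // m lt_mr; rewrite fps_addE Hc // addr0 E.
  elim: s Hs => [|[a b] s IHs] Hs.
    by exists 0 => [|m _]; [exact: span0 | rewrite big_nil mcoeff0].
  have [|g Hg Eg] := IHs; first by move=> q Hq; apply: Hs; rewrite inE Hq orbT.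
  have [p Ip /= Eb] := Hs _ (mem_head _ _).
  exists (fps_trunc r a * translate p + g).
    by apply: spanD => //; rewrite mulrC;
      apply/translated_idealM/translate_in_ideal.
  move=> m lt_mr; rewrite big_cons fps_addE Eg //= mcoeffD; congr (_ + _).
  by rewrite Eb -(fps_mul_trunc_l _ _ lt_mr).
exists (fps_of g), (v - fps_of g); split; last by rewrite addrC subrK.
  elim: Hg => [|c _ w [f [u [+ ->]]] _ [s Hs Ew]].
    exists [::] => //; rewrite big_nil; apply/funext => m; exact: mcoeff0.
  case/mapP => t Ht ->.
  exists ((fps_of (c *: 'X_[u]), expand_at iota x0 (mpoly_of_pol t)) :: s).
    move=> q; rewrite inE => /predU1P[-> /=|/Hs //].
    exists (mpoly_of_pol t) => //; exists [:: (1, mpoly_of_pol t)].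
      by move=> q'; rewrite inE => /eqP -> /=; exists t.
    by rewrite big_seq1 mul1r.
  rewrite big_cons -Ew fps_ofD; congr (_ + _).
  rewrite /= -[expand_at _ _ _]/(fps_of (translate _)).
  by rewrite -fps_ofM -scalerAl mulrC.
apply/ideal_pow_max => m lt_mr.
by rewrite fps_addE fps_oppE Hv // subrr.
Qed.

Definition standard_monomials r : seq 'X_{1..n} :=
  [seq m <- map val (enum {: 'X_{1..n < r}}) | ~~ `[< initial_ideal m >]].

Lemma mem_standard_monomials r m :
  m \in standard_monomials r <-> (mdeg m < r)%N /\ ~ initial_ideal m.
Proof.
rewrite mem_filter; split=> [/andP[/asboolPn Hm /mapP[b _ Eb]]|[lt_mr Hm]].
  by split=> //; rewrite Eb; exact: bmdeg.
apply/andP; split; first exact/asboolPn.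
by apply/mapP; exists (BMultinom lt_mr); rewrite ?mem_enum.
Qed.

Lemma uniq_standard_monomials r : uniq (standard_monomials r).
Proof. by apply: filter_uniq; rewrite map_inj_uniq ?enum_uniq //; exact:
  val_inj. Qed.

(** The lowest term is cancelled by an ideal element if its exponent is initial, and is recorded in
    [c] otherwise; in both cases the next lowest term is larger. *)
Lemma standard_reduction r v : exists c : 'X_{1..n} -> K,
  exists2 g, translated_ideal g & forall m, (mdeg m < r)%N ->
    v m = \sum_(b <- standard_monomials r) c b * (b == m)%:R + g@_m.
Proof.
pose P (v : fps K n) := exists c : 'X_{1..n} -> K,
  exists2 g, translated_ideal g & forall m, (mdeg m < r)%N ->
    v m = \sum_(b <- standard_monomials r) c b * (b == m)%:R + g@_m.
have P0 w : fps_trunc r w = 0 -> P w.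
  move=> w0; exists (fun=> 0), 0; first exact: span0.
  move=> m lt_mr; rewrite -(fps_truncE _ lt_mr) w0 mcoeff0 addr0.
  by rewrite big1 // => i _; rewrite mul0r.
rewrite -/(P v); have [/P0 //|] := eqVneq (fps_trunc r v) 0.
move: {2}(mlast _) (erefl (mlast (fps_trunc r v))) => b; move: b v.
apply: (mon_up_ind (e := r)) => b IHb v Eb v0.
have lt_br : (mdeg b < r)%N.
  rewrite ltnNge; apply: contra_neqN (mcoeff_mlast_neq0 v0) => le_rb.
  rewrite Eb /fps_trunc raddf_sum /= big1 // => i _.
  rewrite mcoeffZ mcoeffX; case: eqP => [Ei|_]; last by rewrite mulr0.
  by move: le_rb; rewrite -Ei leqNgt bmdeg.
have v_lt m : (m < b)%O -> v m = 0.
  move=> lt_mb; have lt_mr : (mdeg m < r)%N.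
    by apply: leq_ltn_trans lt_br; apply/lemc_mdeg/ltW.
  by rewrite -(fps_truncE _ lt_mr) mcoeff_lt_mlast // Eb.
have next w : (forall m, (m <= b)%O -> w m = 0) -> P w.
  move=> Hw; have [/P0 //|w0] := eqVneq (fps_trunc r w) 0.
  have w_supp m : (fps_trunc r w)@_m != 0 -> (mdeg m < r)%N.
    rewrite ltnNge; apply: contra_neqN => le_rm.
    rewrite /fps_trunc raddf_sum /= big1 // => i _.
    rewrite mcoeffZ mcoeffX; case: eqP => [Ei|_]; last by rewrite mulr0.
    by move: le_rm; rewrite -Ei leqNgt bmdeg.
  apply: (IHb _ _ (ltnW (w_supp _ (mcoeff_mlast_neq0 w0))) w erefl w0).
  apply: mlast_gt => // m le_mb; rewrite fps_truncE ?Hw //.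
  by apply: leq_ltn_trans lt_br; apply/lemc_mdeg.
have [[g [Ig g0 Egb]]|Lb] := pselect (initial_ideal b).
  have gb : g@_b != 0 by rewrite -Egb mcoeff_mlast_neq0.
  have [m le_mb|c [g' Ig' Hg']] := next (v - (v b / g@_b) *: fps_of g).
    rewrite fps_addE fps_oppE fps_scaleE /fps_of.
    move: le_mb; rewrite le_eqVlt => /predU1P[->|lt_mb].
      by rewrite divfK ?subrr.
    by rewrite v_lt // [g@_m]mcoeff_lt_mlast ?Egb // mulr0 subr0.
  exists c, ((v b / g@_b) *: g + g'); first exact: spanD (spanZ _ Ig) Ig'.
  move=> m lt_mr; have := Hg' m lt_mr.
  rewrite fps_addE fps_oppE fps_scaleE => /(canRL (subrK _)) ->.
  by rewrite mcoeffD mcoeffZ -addrA [_@_m + _]addrC.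
have [m le_mb|c [g' Ig' Hg']] := next (v - v b *: fps_of 'X_[b]).
  rewrite fps_addE fps_oppE fps_scaleE /fps_of mcoeffX.
  move: le_mb; rewrite le_eqVlt => /predU1P[->|lt_mb].
    by rewrite eqxx mulr1 subrr.
  by rewrite v_lt // gt_eqF // mulr0 subr0.
exists (fun m => c m + v b *+ (m == b)), g' => // m lt_mr.
have := Hg' m lt_mr.
rewrite fps_addE fps_oppE fps_scaleE /fps_of mcoeffX => /(canRL (subrK _)) ->.
rewrite addrAC; congr (_ + _).
under [RHS]eq_bigr do rewrite mulrDl.
rewrite big_split /=; congr (_ + _).
have Hb : b \in standard_monomials r by apply/mem_standard_monomials.
rewrite (big_rem _ Hb) /= eqxx mulr1n big1_seq ?addr0 // => i /=.
rewrite mem_rem_uniq ?uniq_standard_monomials // inE => /andP[/negbTE -> _].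
by rewrite mul0r.
Qed.

(** Existence of coordinates is [standard_reduction]. Two sets of coordinates differ by an ideal
    element that is, below degree [r], a combination of standard monomials, which forces them to
    agree. *)
Lemma is_HSF_standard :
  is_HSF iota (ideal_of_pols gens) x0 (fun r => size (standard_monomials r)).
Proof.
move=> r; set S := standard_monomials r.
exists (fun i => fps_of 'X_[nth 0%MM S i]) => v.
have sumE (c : 'rV[K]_(size S)) m :
    (\sum_i c 0 i *: fps_of 'X_[nth 0%MM S i] : fps K n) m =
    \sum_i c 0 i * (nth 0%MM S i == m)%:R.
  rewrite fps_sumE; apply: eq_bigr => i _.
  by rewrite fps_scaleE /fps_of mcoeffX.
have [c [g Ig Hg]] := standard_reduction r v.
exists (\row_i c (nth 0%MM S i)); split.
  apply/extended_idealP; exists g => // m lt_mr.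
  rewrite fps_addE fps_oppE sumE Hg // (big_nth 0%MM) big_mkord -/S addrAC.
  by under [X in _ - X]eq_bigr do rewrite mxE; rewrite subrr add0r.
move=> c' /extended_idealP[g' Ig' Hg'].
have Igg : translated_ideal (g' - g) by exact: spanB.
pose a (i : 'I_(size S)) := c (nth 0%MM S i) - c' 0 i.
have Ediff m : (mdeg m < r)%N ->
  (g' - g)@_m = \sum_(i < size S) a i * (nth 0%MM S i == m)%:R.
  move=> lt_mr; have := Hg' m lt_mr; rewrite mcoeffB fps_addE fps_oppE sumE =>
    <-.
  rewrite Hg // (big_nth 0%MM) big_mkord -/S.
  rewrite addrAC addrK -sumrB; apply: eq_bigr => i _.
  by rewrite -mulrBl.
have Scoef (i : 'I_(size S)) : (g' - g)@_(nth 0%MM S i) = a i.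
  have /mem_standard_monomials[lt_r _] : nth 0%MM S i \in S by exact: mem_nth.
  rewrite Ediff // (bigD1 i) //= eqxx mulr1 big1 ?addr0 // => j neq_ji.
  by rewrite nth_uniq ?uniq_standard_monomials // val_eqE (negbTE neq_ji) mulr0.
apply/rowP => i; rewrite mxE; apply/eqP; rewrite -subr_eq0 -/(a i).
apply: contraT => ai; have gg0 : g' - g != 0.
  by apply: contraNneq ai => E; rewrite -Scoef E mcoeff0.
have le_last : (mlast (g' - g) <= nth 0%MM S i)%O.
  by apply: mlast_lemc; rewrite mcoeff_msupp Scoef.
have /mem_standard_monomials[lt_ir _] : nth 0%MM S i \in S by exact: mem_nth.
have lt_r : (mdeg (mlast (g' - g)) < r)%N.
  by apply: leq_ltn_trans lt_ir; exact: lemc_mdeg.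
(* The initial monomial of [g' - g] would have to be standard. *)
have := mcoeff_mlast_neq0 gg0; rewrite Ediff //.
rewrite big1 ?eqxx // => j _; case: eqP => [Ej|_]; last by rewrite mulr0.
have /mem_standard_monomials[_ []] : nth 0%MM S j \in S by exact: mem_nth.
by rewrite Ej; exists (g' - g).
Qed.

End HilbertFunction.

(** * Elimination *)

Section Evaluation.
Variables (k K : fieldType) (phi : {rmorphism k -> K}) (n : nat).
Implicit Types (x : 'I_n -> K) (p : upol k) (s r : seq (upol k)).

Definition mon_eval x (m : seq nat) : K := \prod_i x i ^+ nth 0%N m i.

Definition pol_eval x p : K := \sum_(t <- p) phi t.1 * mon_eval x t.2.

Definition pol_wf p : bool := all (fun t => size t.2 == n) p.

Lemma pol_eval_nil x : pol_eval x [::] = 0.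
Proof. exact: big_nil. Qed.

Lemma pol_eval_cat x p q : pol_eval x (p ++ q) = pol_eval x p + pol_eval x q.
Proof. exact: big_cat. Qed.

Lemma pol_eval_opp x p : pol_eval x (pol_opp p) = - pol_eval x p.
Proof.
rewrite /pol_eval big_map -sumrN; apply: eq_bigr => t _.
by rewrite rmorphN mulNr.
Qed.

Lemma mon_eval_add x m1 m2 : size m1 = n ->
  mon_eval x (mon_add m1 m2) = mon_eval x m1 * mon_eval x m2.
Proof.
move=> sz1; rewrite /mon_eval -big_split; apply: eq_bigr => i _ /=.
rewrite (nth_map 0%N) ?size_iota ?sz1 // nth_iota ?sz1 // add0n.
by rewrite exprD.
Qed.

Lemma pol_eval_mul x p q : pol_wf p ->
  pol_eval x (pol_mul p q) = pol_eval x p * pol_eval x q.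
Proof.
move=> /allP wf_p; rewrite /pol_eval /pol_mul big_allpairs_dep mulr_suml.
apply: eq_big_seq => t /wf_p/eqP sz_t; rewrite mulr_sumr; apply: eq_bigr => u _.
by rewrite rmorphM mon_eval_add //= mulrACA.
Qed.

Lemma pol_wf_cat p q : pol_wf (p ++ q) = pol_wf p && pol_wf q.
Proof. exact: all_cat. Qed.

Lemma pol_wf_opp p : pol_wf (pol_opp p) = pol_wf p.
Proof. by rewrite /pol_wf all_map. Qed.

Lemma pol_wf_mul p q : pol_wf p -> pol_wf (pol_mul p q).
Proof.
move=> /allP wf_p; apply/allP => _ /allpairsP[[t u] [/wf_p sz_t _ ->]] /=.
by rewrite size_map size_iota.
Qed.

Lemma pol_eval_prod x ps : all pol_wf ps ->
  pol_eval x (pol_prod n ps) = \prod_(p <- ps) pol_eval x p.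
Proof.
elim: ps => [|p ps IHps] /=; last first.
  by case/andP=> wf_p wf_ps; rewrite big_cons -IHps // pol_eval_mul.
rewrite big_nil /pol_eval big_seq1 rmorph1 mul1r /mon_eval big1 // => i _.
by rewrite nth_nseq ltn_ord.
Qed.

Lemma pol_wf_prod ps : all pol_wf ps -> pol_wf (pol_prod n ps).
Proof.
elim: ps => [|p ps IHps] /=; first by rewrite size_nseq eqxx.
by case/andP=> wf_p wf_ps; apply: pol_wf_mul.
Qed.

Definition rows_wf (q : nat) (rows : seq (seq (upol k))) : bool :=
  all (fun s => (size s == q) && all pol_wf s) rows.

Lemma pol_wf_nth s j : all pol_wf s -> pol_wf (nth [::] s j).
Proof.
move=> /allP wf_s; have [lt_j|le_j] := ltnP j (size s).
  by apply: wf_s; rewrite mem_nth.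
by rewrite nth_default.
Qed.

Lemma rows_wf_behead q rows : rows_wf q.+1 rows -> rows_wf q (map behead rows).
Proof.
move=> /allP wf; apply/allP => _ /mapP[s /wf/andP[/eqP sz_s wf_s] ->].
by rewrite size_behead sz_s eqxx; case: s wf_s {sz_s} => //= p s /andP[].
Qed.

Lemma rows_wf_reduce q rows (r : seq (upol k)) : r \in rows ->
  rows_wf q.+1 rows ->
  rows_wf q (reduce r rows).
Proof.
move=> r_in /allP wf; apply/allP => _ /mapP[s /wf/andP[/eqP sz_s wf_s] ->].
have /andP[/eqP sz_r wf_r] := wf r r_in.
rewrite size_map size_iota sz_r eqxx; apply/allP => _ /mapP[j _ ->].
rewrite pol_wf_cat pol_wf_opp -!nth0 !pol_wf_mul //; exact: pol_wf_nth.
Qed.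

(** Column [j] becomes the coefficient of degree [j]: rows of all lengths share one vector space,
    and removing a zero first column is division by ['X]. *)
Definition row_poly x s : {poly K} := Poly (map (pol_eval x) s).

Definition row_space x (rows : seq (seq (upol k))) : {poly K} -> Prop :=
  span (fun v => exists2 s, s \in rows & v = row_poly x s).

(** This describes the pivot columns of an echelon form without choosing one. *)
Definition lead x rows j : Prop := exists v,
  [/\ row_space x rows v, v`_j != 0 & forall i, (i < j)%N -> v`_i = 0].

Lemma coef_row_poly x s j : (row_poly x s)`_j = pol_eval x (nth [::] s j).
Proof.
rewrite coef_Poly; have [lt_j|le_j] := ltnP j (size s).
  by rewrite (nth_map [::]).
by rewrite !nth_default ?size_map ?pol_eval_nil.
Qed.

Lemma row_poly_behead x s : pol_eval x (head [::] s) = 0 ->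
  row_poly x s = row_poly x (behead s) * 'X.
Proof.
move=> s0; apply/polyP => -[|j]; rewrite coefMX coef_row_poly /=.
  by rewrite nth0.
by rewrite coef_row_poly nth_behead.
Qed.

Lemma row_poly_reduce x q r s : size r = q.+1 -> size s = q.+1 ->
  all pol_wf r -> all pol_wf s ->
  row_poly x [seq pol_mul (head [::] r) (nth [::] s j.+1) ++
                  pol_opp (pol_mul (head [::] s) (nth [::] r j.+1))
             | j <- iota 0 (size r).-1] * 'X =
  pol_eval x (head [::] r) *: row_poly x s -
  pol_eval x (head [::] s) *: row_poly x r.
Proof.
move=> sz_r sz_s wf_r wf_s; apply/polyP => -[|j].
  by rewrite coefMX coefB !coefZ !coef_row_poly /= !nth0 mulrC subrr.
rewrite coefMX coefB !coefZ !coef_row_poly /= sz_r /=.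
have [lt_jq|le_qj] := ltnP j q.
  rewrite (nth_map 0%N) ?size_iota // nth_iota // add0n.
  rewrite pol_eval_cat pol_eval_opp -!nth0 !pol_eval_mul //; exact: pol_wf_nth.
rewrite !nth_default ?size_map ?size_iota ?sz_r ?sz_s //.
by rewrite pol_eval_nil !mulr0 subrr.
Qed.

Lemma lead0_zero x rows :
  (forall s, s \in rows -> pol_eval x (head [::] s) = 0) -> ~ lead x rows 0.
Proof.
move=> H0 [v [Hv v0 _]]; move/eqP: v0; apply.
elim: Hv => [|c _ w [s /H0 s0 ->] _ IHw]; first by rewrite coef0.
by rewrite coefD coefZ IHw coef_row_poly nth0 s0 mulr0 addr0.
Qed.

Lemma leadS_zero x rows j :
  (forall s, s \in rows -> pol_eval x (head [::] s) = 0) ->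
  lead x rows j.+1 <-> lead x (map behead rows) j.
Proof.
move=> H0; split=> [[v [Hv vj v_lt]]|[v [Hv vj v_lt]]].
  have [w Hw Ev] : exists2 w, row_space x (map behead rows) w & v = w * 'X.
    elim: Hv => [|c _ v' [s s_in ->] _ [w Hw ->]].
      by exists 0; [exact: span0 | rewrite mul0r].
    exists (c *: row_poly x (behead s) + w).
      by apply: span_cons => //; exists (behead s) => //; exact: map_f.
    by rewrite mulrDl -scalerAl -row_poly_behead ?H0.
  exists w; split=> // [|i lt_ij]; first by move: vj; rewrite Ev coefMX.
  by have := v_lt i.+1 lt_ij; rewrite Ev coefMX.
exists (v * 'X); split; first 1 last.
- by rewrite coefMX.
- by case=> [|i]; rewrite coefMX //=; exact: v_lt.
apply: (span_linear (f := 'X \o* idfun)) Hv => _ [_ /mapP[s s_in ->] ->] /=.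
by apply: span_gen; exists s => //; rewrite -row_poly_behead ?H0.
Qed.

Lemma lead0_pivot x rows r : r \in rows -> pol_eval x (head [::] r) != 0 ->
  lead x rows 0.
Proof.
move=> r_in r0; exists (row_poly x r); split=> //.
  by apply: span_gen; exists r.
by rewrite coef_row_poly nth0.
Qed.

Lemma leadS_pivot x q rows r j : rows_wf q.+1 rows -> r \in rows ->
  pol_eval x (head [::] r) != 0 ->
  lead x rows j.+1 <-> lead x (reduce r rows) j.
Proof.
move=> /allP wf r_in r0; have /andP[/eqP sz_r wf_r] := wf r r_in.
pose a := pol_eval x (head [::] r).
split=> [[v [Hv vj v_lt]]|[v [Hv vj v_lt]]].
  (* Up to the nonzero factor [a], a combination of rows is a shifted combination of reduced rows
     plus a multiple of the pivot row. *)
  have [w [c [Hw Ev]]] : exists w c, row_space x (reduce r rows) w /\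
      a *: v = w * 'X + c *: row_poly x r.
    elim: Hv => [|c _ v' [s s_in ->] _ [w [c' [Hw Ev']]]].
      exists 0, 0; split; first exact: span0.
      by rewrite scaler0 mul0r scale0r addr0.
    have /andP[/eqP sz_s wf_s] := wf s s_in.
    have Es := row_poly_reduce x sz_r sz_s wf_r wf_s.
    set s' := [seq _ | _ <- _] in Es.
    exists (c *: row_poly x s' + w), (c * pol_eval x (head [::] s) + c'); split.
      by apply: span_cons => //; exists s' => //; apply/mapP; exists s.
    rewrite scalerDr Ev' mulrDl -scalerAl Es scalerBr !scalerA scalerDl.
    by rewrite [a * c]mulrC addrACA subrK addrA.
  (* In column 0 both [v] and [w * 'X] vanish, whereas the pivot row does not. *)
  have c0 : c = 0.
    have := v_lt 0%N isT => v0; move/(congr1 (fun u : {poly K} => u`_0)): Ev.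
    rewrite coefZ v0 mulr0 coefD coefMX coefZ coef_row_poly nth0 add0r.
    by move/esym/eqP; rewrite mulf_eq0 (negbTE r0) orbF => /eqP.
  have Ev' i : w`_i = a * v`_i.+1.
    by rewrite -coefZ Ev c0 scale0r addr0 coefMX.
  exists w; split=> // [|i lt_ij]; first by rewrite Ev' mulf_neq0.
  by rewrite Ev' v_lt ?mulr0.
exists (v * 'X); split; first 1 last.
- by rewrite coefMX.
- by case=> [|i]; rewrite coefMX //=; exact: v_lt.
apply: (span_linear (f := 'X \o* idfun)) Hv => _ [_ /mapP[s s_in ->] ->] /=.
have /andP[/eqP sz_s wf_s] := wf s s_in.
rewrite (row_poly_reduce x sz_r sz_s wf_r wf_s).
by apply: spanB; apply: spanZ; apply: span_gen; [exists s | exists r].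
Qed.

Lemma mem_pivots q M i A s : (i < q)%N -> A \in iter i (@branch k) [:: M] ->
  s \in A -> head [::] s \in pivots q M.
Proof.
move=> lt_iq A_in s_in; apply/flattenP.
exists (flatten [seq map (head [::]) rows | rows <- iter i (@branch k) [:: M]]).
  by apply/mapP; exists i => //; rewrite mem_iota.
apply/flattenP; exists (map (head [::]) A); last exact: map_f.
exact: (map_f (fun rows => map (head [::]) rows)).
Qed.

Lemma pivots_wf q M : rows_wf q M -> all pol_wf (pivots q M).
Proof.
move=> wf_M; have wf_iter i A : (i <= q)%N -> A \in iter i (@branch k) [::
  M] -> rows_wf (q - i) A.
  elim: i A => [|i IHi] A; first by rewrite inE subn0 => _ /eqP ->.
  move=> lt_iq /flattenP[l /mapP[rows /(IHi _ (ltnW lt_iq))]].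
  rewrite -(subnSK lt_iq) => wf_rows ->; rewrite inE =>
    /predU1P[->|/mapP[r r_in ->]].
    exact: rows_wf_behead.
  exact: rows_wf_reduce.
apply/allP => p /flattenP[_ /mapP[i + ->]].
move=> + /flattenP[_ /mapP[A A_in ->] /mapP[s s_in ->]].
rewrite mem_iota => /= lt_iq;
  have /allP/(_ s s_in)/andP[_] := wf_iter _ _ (ltnW lt_iq) A_in.
by rewrite -nth0; exact: pol_wf_nth.
Qed.

(** Points with the same vanishing pattern can follow the same branch of the elimination, choosing
    the same pivot rows throughout. *)
Lemma pivots_lead q M x x' : rows_wf q M ->
  (forall p, p \in pivots q M -> (pol_eval x p == 0) = (pol_eval x' p == 0)) ->
  forall j, (j < q)%N -> lead x M j <-> lead x' M j.
Proof.
move=> wf_M same j lt_jq.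
(* The claim is generalised to any matrix [A] reached after [i] rounds, with [r] columns left. *)
suff /(_ q 0%N M) : forall (r i : nat) A, (i + r)%N = q ->
  A \in iter i (@branch k) [:: M] ->
    rows_wf r A -> forall j, (j < r)%N -> lead x A j <-> lead x' A j.
  by apply=> //; rewrite inE.
elim=> // r IHr i A Eq A_in wf_A {j lt_jq} j lt_jr.
have lt_iq : (i < q)%N by rewrite -Eq addnS ltnS leq_addr.
have Eq' : (i.+1 + r)%N = q by rewrite addSnnS.
have same_head s : s \in A ->
    (pol_eval x (head [::] s) == 0) = (pol_eval x' (head [::] s) == 0).
  by move=> s_in; apply: same; exact: mem_pivots lt_iq A_in s_in.
have [all0|] := boolP (all (fun s => pol_eval x (head [::] s) == 0) A).
  have H0 s : s \in A -> pol_eval x (head [::] s) = 0 by move/(allP all0)/eqP.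
  have H0' s : s \in A -> pol_eval x' (head [::] s) = 0.
    by move=> s_in; apply/eqP; rewrite -same_head // H0.
  case: j lt_jr => [_|j lt_jr]; first by split=> /lead0_zero; case.
  rewrite (leadS_zero _ H0) (leadS_zero _ H0').
  apply: IHr Eq' _ (rows_wf_behead wf_A) _ lt_jr.
  apply/flattenP; exists (map behead A :: [seq reduce r0 A | r0 <- A]).
    by apply: (map_f (fun rows => map behead rows ::
      [seq reduce r0 rows | r0 <- rows])).
  exact: mem_head.
case/allPn => s s_in s0; have s0' :
  pol_eval x' (head [::] s) != 0 by rewrite -same_head.
case: j lt_jr => [_|j lt_jr].
  by split=> _; [exact: lead0_pivot s0' | exact: lead0_pivot s0].
rewrite (leadS_pivot _ wf_A s_in s0) (leadS_pivot _ wf_A s_in s0').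
apply: IHr Eq' _ (rows_wf_reduce s_in wf_A) _ lt_jr.
apply/flattenP; exists (map behead A :: [seq reduce r0 A | r0 <- A]).
  by apply: (map_f (fun rows => map behead rows ::
    [seq reduce r0 rows | r0 <- rows])).
by rewrite inE; apply/orP; right; exact: (map_f (fun r0 => reduce r0 A)).
Qed.

End Evaluation.

(** * The matrix of jets *)

(** Splitting the lists of zeros and ones by their first entry gives Pascal's rule. *)
Lemma binE m c : bin m c = 'C(m, c).
Proof.
rewrite /bin size_filter; elim: m c => [|m IHm] [|c] //=.
  rewrite !cats0 count_cat !count_map.
  rewrite [X in (_ + X)%N](eq_count (a2 := pred0)) ?count_pred0 ?addn0 //.
  by rewrite -[RHS](bin0 m) -IHm; apply: eq_count => s.
rewrite !cats0 count_cat !count_map binS -!IHm.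
by congr (_ + _)%N; apply: eq_count => s.
Qed.

Lemma leq_sumn m s : m \in s -> (m <= sumn s)%N.
Proof.
elim: s => //= a s IHs; rewrite inE => /predU1P[->|/IHs le_m]; first exact:
  leq_addr.
exact: leq_trans le_m (leq_addl _ _).
Qed.

Section Exponents.
Variable n : nat.
Implicit Types (a b m : 'X_{1..n}) (s : seq nat).

Definition mnm_of_seq s : 'X_{1..n} := [multinom nth 0%N s i | i < n].

Lemma mnm_of_seqK s : size s = n -> mnm_of_seq s = s :> seq nat.
Proof.
move=> sz_s; apply: (@eq_from_nth _ 0%N); first by rewrite size_tuple sz_s.
move=> i; rewrite size_tuple => lt_in.
by rewrite -[i]/(val (Ordinal lt_in)) -mnm_nth mnmE.
Qed.

Lemma mnm_of_mnm m : mnm_of_seq m = m.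
Proof. by apply/mnmP => i; rewrite mnmE -mnm_nth. Qed.

Lemma mon_le_mnm a b : mon_le a b = (a <= b)%MM.
Proof.
rewrite /mon_le size_tuple; apply/allP/mnm_lepP => [le_ab i|le_ab i].
  by rewrite !(mnm_nth 0%N); apply: le_ab; rewrite mem_iota /=.
rewrite mem_iota add0n /= => lt_in.
by have := le_ab (Ordinal lt_in); rewrite !(mnm_nth 0%N).
Qed.

Lemma mon_sub_mnm a b : mon_sub a b = (a - b)%MM :> seq nat.
Proof.
rewrite /mon_sub size_tuple; apply: (@eq_from_nth _ 0%N) => [|i].
  by rewrite size_map size_iota size_tuple.
rewrite size_map size_iota => lt_in.
rewrite (nth_map 0%N) ?size_iota // nth_iota // add0n.
by rewrite -[i]/(val (Ordinal lt_in)) -!mnm_nth mnmBE.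
Qed.

Lemma multibinE a b : multibin a b = (\prod_i 'C(a i, b i))%N.
Proof.
rewrite /multibin size_tuple;
  transitivity (\prod_(i <- iota 0 n) 'C(nth 0 a i, nth 0 b i))%N.
  by elim: (iota 0 n) => [|i s IHs]; rewrite ?big_nil // big_cons -IHs /= binE.
have -> : iota 0 n = index_iota 0 n by rewrite /index_iota subn0.
rewrite big_mkord.
by apply: eq_bigr => i _; rewrite !(mnm_nth 0%N).
Qed.

Lemma sumn_mnm m : sumn m = mdeg m.
Proof. by rewrite /mdeg sumnE. Qed.

End Exponents.

Section Taylor.
Variables (k K : fieldType) (phi : {rmorphism k -> K}) (n : nat).
Implicit Types (x : 'I_n -> K) (a b e m : 'X_{1..n}).

(** When the product is expanded over all choices of exponents, only the choice [b] contributes. *)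
Lemma mcoeff_prod_univariate (N : nat) (c : 'I_n -> nat -> K) b :
  (forall i, b i < N)%N ->
  (\prod_i (\sum_(j < N) c i j *: 'X_i ^+ j : {mpoly K[n]}))@_b =
  \prod_i c i (b i).
Proof.
move=> lt_bN; rewrite bigA_distr_bigA /= raddf_sum /=.
pose fb : {ffun 'I_n -> 'I_N} := [ffun i => Ordinal (lt_bN i)].
have termE (f : {ffun 'I_n -> 'I_N}) :
    \prod_i (c i (f i) *: 'X_i ^+ f i : {mpoly K[n]}) =
    (\prod_i c i (f i)) *: 'X_[[multinom val (f i) | i < n]].
  rewrite scaler_prod; congr (_ *: _); rewrite [RHS]mpolyXE_id.
  by apply: eq_bigr => i _; rewrite mnmE.
rewrite (bigD1 fb) //= termE mcoeffZ mcoeffX [X in _ + X]big1 ?addr0.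
  rewrite (_ : [multinom _ | i < n] == b); last first.
    by apply/eqP/mnmP => i; rewrite mnmE ffunE.
  by rewrite mulr1; apply: eq_bigr => i _; rewrite ffunE.
move=> f neq_f; rewrite termE mcoeffZ mcoeffX; case: eqP => [Ef|];
  last by rewrite mulr0.
case/eqP: neq_f; apply/ffunP => i; apply: val_inj; rewrite ffunE /=.
by rewrite -Ef mnmE.
Qed.

(** The range is padded to an [N] common to all variables, as [mcoeff_prod_univariate] demands; the
    extra binomials vanish. *)
Lemma expr_shift x (i : 'I_n) (e N : nat) : (e < N)%N ->
  ('X_i + (x i)%:MP : {mpoly K[n]}) ^+ e =
  \sum_(j < N) (x i ^+ (e - j) *+ 'C(e, j)) *: 'X_i ^+ j.
Proof.
move=> lt_eN; rewrite addrC exprDn.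
rewrite (big_ord_widen N (fun j =>
  ((x i)%:MP ^+ (e - j) * 'X_i ^+ j *+ 'C(e, j)))) //.
rewrite big_mkcond; apply: eq_bigr => j _; case: ltnP => [_|le_ej].
  by rewrite -rmorphXn /= mul_mpolyC -scalerMnl.
by rewrite bin_small // scale0r.
Qed.

Lemma mcoeff_translateX x e b :
  (translate phi x 'X_[e])@_b =
  (multibin e b)%:R * mon_eval x (mon_sub e b).
Proof.
rewrite /translate map_mpolyX comp_mpolyX.
pose N := (mdeg e + mdeg b).+1.
have lt_N m i : (m i <= mdeg m)%N by rewrite mdegE (bigD1 i) //= leq_addr.
under eq_bigr => i _.
  rewrite tnth_mktuple (@expr_shift _ _ _ N); last first.
    by rewrite ltnS; apply: leq_trans (leq_addr _ _).
  over.
rewrite (@mcoeff_prod_univariate N (fun i j => x i ^+ (e i - j) *+ 'C(e i, j))).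
  rewrite multibinE natr_prod /mon_eval -big_split; apply: eq_bigr => i _ /=.
  by rewrite mon_sub_mnm -mnm_nth mnmBE mulr_natl.
by move=> i; rewrite ltnS; apply: leq_trans (leq_addl _ _).
Qed.

Definition untype (s : pol k n) : upol k := [seq (t.1, t.2 : seq nat) | t :
  k * 'X_{1..n} <- s].

Lemma translateZ x (c : k) p : translate phi x (c *: p) = phi c *:
  translate phi x p.
Proof. by rewrite /translate map_mpolyZ comp_mpolyZ. Qed.

Lemma pol_eval_taylor x (s : pol k n) b :
  pol_eval phi x (taylor (untype s) b) = (translate phi x (mpoly_of_pol s))@_b.
Proof.
rewrite /mpoly_of_pol translate_sum raddf_sum /= /taylor -map_comp.
elim: s => [|t s IHs]; first by rewrite big_nil pol_eval_nil.
rewrite big_cons /= pol_eval_cat IHs; congr (_ + _).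
rewrite translateZ mcoeffZ mcoeff_translateX.
elim: (multibin _ _) => [|j IHj]; first by rewrite mul0r mulr0 pol_eval_nil.
rewrite /= /pol_eval big_cons -/(pol_eval _ _ _) IHj.
rewrite -addn1 natrD mulrDl mul1r mulrDr.
by rewrite addrC.
Qed.

Lemma pol_eval_entry x (s : pol k n) a b :
  pol_eval phi x (entry (untype s) a b) =
  (translate phi x (mpoly_of_pol s) * 'X_[a])@_b.
Proof.
rewrite /entry mon_le_mnm; case: ifPn => [le_ab|not_ab].
  by rewrite mon_sub_mnm pol_eval_taylor -{2}(submK le_ab) addmC mcoeffMX.
rewrite pol_eval_nil; apply/esym/eqP;
  rewrite mcoeff_eq0 (perm_mem (msuppMX _ _)).
by apply: contraNN not_ab => /mapP[m _ ->]; rewrite lem_addr.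
Qed.

(** If [m] has larger degree than [e], then [m i] exceeds [e i] for some [i]; that binomial factor
    is zero, and [taylor] lists no copy of the term. *)
Lemma translate_mdeg x (gens : seq (pol k n)) f m :
  f \in translated_gens phi gens x -> m \in msupp f ->
  (mdeg m <= deg_bound [seq untype s | s <- gens])%N.
Proof.
case/mapP => s s_in ->; rewrite mcoeff_msupp -pol_eval_taylor.
apply: contraNleq => lt_m; rewrite /taylor (_ :
  flatten _ = [::]) ?pol_eval_nil //.
apply/nilP; rewrite /nilp size_flatten /shape -map_comp sumnE big_map.
rewrite big1_seq // => -[c t] /= /mapP[[c' e] e_in [_ ->]].
rewrite size_nseq multibinE.
have lt_em : (mdeg e < mdeg m)%N.
  apply: leq_ltn_trans lt_m; apply/leqW/leq_sumn/flattenP.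
  exists [seq sumn t.2 | t <- untype s]; first by apply/mapP;
    exists (untype s) => //; exact: map_f.
  apply/mapP; exists (c', e : seq nat); last by rewrite /= sumn_mnm.
  by apply/mapP; exists (c', e).
have /existsP[i lt_i] : [exists i, (e i < m i)%N].
  apply: contraLR lt_em; rewrite negb_exists -leqNgt => /forallP le_me.
  by rewrite !mdegE; apply: leq_sum => i _; rewrite leqNgt.
by rewrite (bigD1 i) //= bin_small.
Qed.

End Taylor.

(** * The order of the columns *)

Lemma pairwise_flatten_map (T : eqType) (I : Type) (r : rel T) (rI : rel I)
    (F : I -> seq T) (s : seq I) :
  (forall i, pairwise r (F i)) ->
  (forall i j x y, rI i j -> x \in F i -> y \in F j -> r x y) ->
  pairwise rI s -> pairwise r (flatten (map F s)).
Proof.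
move=> HF Hr; elim: s => //= i s IHs /andP[Hi /IHs Hs].
rewrite pairwise_cat HF Hs !andbT; apply/allrelP => x y x_in.
elim: s Hi {IHs Hs} => //= j s IHs /andP[r_ij /IHs IH].
by rewrite mem_cat => /orP[|/IH //]; apply: Hr x_in.
Qed.

Lemma pairwise_iota m n : pairwise ltn (iota m n).
Proof. by rewrite -sorted_pairwise ?iota_ltn_sorted //; exact: ltn_trans. Qed.

Fixpoint seq_lt (s t : seq nat) : bool :=
  if s is x :: s' then
    if t is y :: t' then (x < y)%N || (x == y) && seq_lt s' t' else false
  else false.

Lemma seq_ltP s t : seq_lt s t -> exists i,
  [/\ (i < size s)%N, forall j, (j < i)%N -> nth 0%N s j = nth 0%N t j
    & (nth 0%N s i < nth 0%N t i)%N].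
Proof.
elim: s t => [|x s IHs] [|y t] //=
  /orP[lt_xy|/andP[/eqP <- /IHs[i [lt_is eq_lt lt_i]]]].
  by exists 0%N.
by exists i.+1; split=> // -[|j] //=; exact: eq_lt.
Qed.

Lemma pairwise_box c N : pairwise seq_lt (box c N).
Proof.
elim: N => // N IHN; rewrite /box iterS -/(box c N).
apply: (@pairwise_flatten_map _ _ _ ltn) (pairwise_iota _ _) => [x|x y s t].
  by rewrite pairwise_map; apply: sub_pairwise IHN => s t /=; rewrite eqxx ltnn.
by move=> /= lt_xy /mapP[s' _ ->] /mapP[t' _ ->] /=; rewrite lt_xy.
Qed.

Definition deg_lt s t : bool :=
  (sumn s < sumn t)%N || (sumn s == sumn t) && seq_lt s t.

Lemma pairwise_cols n D : pairwise deg_lt (cols n D).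
Proof.
apply: (@pairwise_flatten_map _ _ _ ltn) (pairwise_iota _ _) => [r|r r' s t].
  have : pairwise seq_lt [seq b <- box D n | sumn b == r].
    exact/pairwise_filter/pairwise_box.
  have : all (fun b => sumn b == r) [seq b <- box D n | sumn b == r].
    exact: filter_all.
  elim: [seq _ <- _ | _] => //= s l IHl /andP[/eqP Es Hl] /andP[lt_s Hp].
  rewrite IHl // andbT; apply/allP => t t_in.
  by rewrite /deg_lt Es eq_sym (allP Hl) // (allP lt_s) // orbT.
rewrite !mem_filter => lt_rr /andP[/eqP Es _] /andP[/eqP Et _].
by rewrite /deg_lt Es Et; apply/orP; left.
Qed.

Lemma mem_cols n D s : (s \in cols n D) = (size s == n) && (sumn s <= D)%N.
Proof.
apply/flattenP/andP => [[_ /mapP[r + ->]]|[sz_s le_sD]].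
  rewrite mem_iota mem_filter mem_box => /= lt_rD /and3P[/eqP -> -> _].
  by split.
exists [seq b <- box D n | sumn b == sumn s].
  by apply/mapP; exists (sumn s) => //; rewrite mem_iota.
rewrite mem_filter eqxx mem_box sz_s; apply/allP => a /leq_sumn le_a.
exact: leq_trans le_sD.
Qed.

Section Columns.
Variables n D : nat.
Implicit Types (a b m : 'X_{1..n}).

Lemma deg_lt_mnm a b : deg_lt a b -> (a < b)%O.
Proof.
rewrite /deg_lt !sumn_mnm => /orP[/lt_mdeg_ltmc //|/andP[/eqP eq_deg /seq_ltP]].
case=> i [+ eq_lt lt_i]; rewrite size_tuple => lt_in; apply/ltmcP => //.
exists (Ordinal lt_in) => [j lt_ji|]; rewrite !(mnm_nth 0%N) //.
exact: eq_lt.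
Qed.

Definition mcol j : 'X_{1..n} := mnm_of_seq n (nth [::] (cols n D) j).

Lemma mcolE j : (j < size (cols n D))%N ->
  mcol j = nth [::] (cols n D) j :> seq nat.
Proof.
move=> lt_j; rewrite mnm_of_seqK //.
by have := mem_nth [::] lt_j; rewrite mem_cols => /andP[/eqP].
Qed.

Lemma mcol_lt i j : (i < j)%N -> (j < size (cols n D))%N -> (mcol i < mcol j)%O.
Proof.
move=> lt_ij lt_j; have lt_i := ltn_trans lt_ij lt_j.
apply: deg_lt_mnm; rewrite !mcolE //.
have /(pairwiseP [::]) := pairwise_cols n D; exact.
Qed.

Lemma mcolP m : (mdeg m <= D)%N ->
  exists2 j, (j < size (cols n D))%N & m = mcol j.
Proof.
move=> le_mD; have m_in : (m : seq nat) \in cols n D.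
  by rewrite mem_cols size_tuple eqxx sumn_mnm.
exists (index (m : seq nat) (cols n D)); first by rewrite index_mem.
by rewrite /mcol nth_index ?mnm_of_mnm.
Qed.

Lemma mcol_mdeg j : (j < size (cols n D))%N -> (mdeg (mcol j) <= D)%N.
Proof.
by move=> lt_j; have := mem_nth [::] lt_j;
  rewrite mem_cols -mcolE // sumn_mnm => /andP[].
Qed.

End Columns.

(** * Pivot columns and initial monomials *)

Section JetMatrix.
Variables (k K : fieldType) (phi : {rmorphism k -> K}) (n D : nat).
Variables (gens : seq (pol k n)).
Implicit Types (x : 'I_n -> K) (a b m : 'X_{1..n}).

Let q := size (cols n D).
Let M := jet_matrix n D [seq untype s | s <- gens].

Definition jet_poly (p : {mpoly K[n]}) :
  {poly K} := \poly_(j < q) p@_(mcol n D j).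

Lemma jet_poly_is_linear : linear jet_poly.
Proof.
move=> c p p'; apply/polyP => j; rewrite coefD coefZ !coef_poly.
by case: ifP => _; rewrite ?mulr0 ?addr0 // mcoeffD mcoeffZ.
Qed.

HB.instance Definition _ :=
  GRing.isLinear.Build K {mpoly K[n]} {poly K} _ jet_poly jet_poly_is_linear.

Lemma jet_matrixP r : r \in M <-> exists s a,
  [/\ s \in gens, (a :
    seq nat) \in box D n & r = [seq entry (untype s) a c | c <- cols n D]].
Proof.
split=> [/allpairsP[[f a] [/mapP[s s_in Ef] a_in ->]]|[s [a [s_in a_in ->]]]].
  have sz_a : size a = n by move: a_in; rewrite mem_box => /andP[/eqP].
  exists s, (mnm_of_seq n a); rewrite mnm_of_seqK //; split=> //=.
  by rewrite -Ef.
apply/allpairsP; exists (untype s, a : seq nat); split=> //=.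
by apply/mapP; exists s.
Qed.

Lemma row_poly_jet x s a :
  row_poly phi x [seq entry (untype s) a c | c <- cols n D] =
  jet_poly (translate phi x (mpoly_of_pol s) * 'X_[a]).
Proof.
apply/polyP => j; rewrite coef_row_poly coef_poly; case: ltnP => [lt_jq|le_qj].
  by rewrite (nth_map [::]) // -mcolE // pol_eval_entry.
by rewrite nth_default ?size_map // pol_eval_nil.
Qed.

Lemma row_space_jet x v : row_space phi x M v <->
  exists2 g, translated_ideal phi gens x g & v = jet_poly g.
Proof.
split=> [|[g Hg ->]].
  elim=> [|c _ w [r /jet_matrixP[s [a [s_in _ ->]]] ->] _ [g Hg ->]].
    by exists 0; [exact: span0 | rewrite linear0].
  exists (c *: (translate phi x (mpoly_of_pol s) * 'X_[a]) + g).
    by apply: span_cons => //; exists (translate phi x (mpoly_of_pol s)), a;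
      split=> //; exact: map_f.
  by rewrite linearP row_poly_jet.
apply: span_linear Hg => _ [f [a [/mapP[s s_in ->] ->]]] /=.
have [a_in|a_notin] := boolP ((a : seq nat) \in box D n).
  apply: span_gen; exists [seq entry (untype s) a c | c <- cols n D].
    by apply/jet_matrixP; exists s, a.
  by rewrite row_poly_jet.
(* An exponent of [a] exceeds [D], so the multiple has no term of degree at most [D]. *)
rewrite (_ : jet_poly _ = 0); first exact: span0.
apply/polyP => j; rewrite coef_poly coef0; case: ifP => // lt_jq.
apply/eqP; rewrite mcoeff_eq0 (perm_mem (msuppMX _ _)).
apply: contra a_notin => /mapP[m _ Em]; rewrite mem_box size_tuple eqxx.
apply/allP => e /tnthP[i ->]; apply: leq_trans (mcol_mdeg lt_jq).
by rewrite Em mdegD mdegE (bigD1 i) //= -addnA leq_addr.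
Qed.

(** The columns increase in the monomial order, so the first nonzero entry of a jet sits at the
    initial monomial. *)
Lemma lead_jet x j : (j < q)%N ->
  lead phi x M j <-> initial_ideal phi gens x (mcol n D j).
Proof.
have coef_jet g i : (i < q)%N -> (jet_poly g)`_i = g@_(mcol n D i).
  by move=> lt_iq; rewrite coef_poly lt_iq.
move=> lt_jq; split=> [[v [/row_space_jet[g Hg ->] + g_lt]]|[g [Hg g0 Ej]]].
  rewrite coef_jet // => gj; have g0 : g != 0.
    by apply: contraNneq gj => ->; rewrite mcoeff0.
  exists g; split=> //; apply: mlastE => [|m]; first by rewrite mcoeff_msupp.
  rewrite mcoeff_msupp leNgt; apply: contraNN => lt_m.
  (* The order refines the degree, so every smaller monomial has a column too. *)
  have le_mD : (mdeg m <= D)%N.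
    by apply: leq_trans (mcol_mdeg lt_jq); exact/lemc_mdeg/ltW.
  have [i lt_iq Em] := mcolP le_mD.
  have lt_ij : (i < j)%N.
    rewrite ltnNge leq_eqVlt; apply/negP => /predU1P[Eij|lt_ji].
      by move: lt_m; rewrite Em Eij ltxx.
    by have := lt_trans lt_m (mcol_lt lt_ji lt_iq); rewrite -Em ltxx.
  by rewrite Em -coef_jet // g_lt.
exists (jet_poly g); split; first by apply/row_space_jet; exists g.
  by rewrite coef_jet // -Ej mcoeff_mlast_neq0.
move=> i lt_ij; rewrite coef_jet ?mcoeff_lt_mlast // ?Ej ?mcol_lt //.
exact: ltn_trans lt_jq.
Qed.

Lemma jet_matrix_wf : rows_wf n q M.
Proof.
apply/allP => r /jet_matrixP[s [a [_ _ ->]]]; rewrite size_map eqxx.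
apply/allP => _ /mapP[b _ ->]; rewrite /entry; case: ifP => // _.
apply/allP => t /flattenP[_ /mapP[_ /mapP[[c e] _ ->] ->]] /nseqP[-> _] /=.
by rewrite size_map size_iota size_tuple.
Qed.

Lemma initial_idealMX x b u : initial_ideal phi gens x b ->
  initial_ideal phi gens x (b + u)%MM.
Proof.
case=> g [Hg g0 <-]; exists (g * 'X_[u]); split; first exact: translated_idealM.
  exact: mulX_neq0.
by rewrite mlastMX // addmC.
Qed.

(** Both sets are generated in degree at most [D], and there they are read off from the pivot
    columns. *)
Lemma initial_ideal_locus x x' :
  (forall y b, initial_ideal phi gens y b -> exists w,
     [/\ (mdeg w <= D)%N, initial_ideal phi gens y w & (w <= b)%MM]) ->
  (forall p, p \in pivots q M ->
     (pol_eval phi x p == 0) = (pol_eval phi x' p == 0)) ->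
  forall b, initial_ideal phi gens x b <-> initial_ideal phi gens x' b.
Proof.
move=> Hgen same; have low w : (mdeg w <= D)%N ->
    initial_ideal phi gens x w <-> initial_ideal phi gens x' w.
  case/mcolP => j lt_jq ->; rewrite -!lead_jet //.
  exact: pivots_lead jet_matrix_wf same _ lt_jq.
by move=> b; split=> /Hgen[w [le_wD Hw /submK <-]]; rewrite addmC;
  apply: initial_idealMX; apply/low.
Qed.

End JetMatrix.

(** * Stratification *)

Section Partition.
Variables (k K : fieldType) (phi : {rmorphism k -> K}) (n : nat).
Implicit Types (x : 'I_n -> K) (P : seq (upol k)).

Definition in_stratum x (s : seq (upol k) * seq (upol k)) : bool :=
  all (fun p => pol_eval phi x p == 0) s.1 &&
  all (fun p => pol_eval phi x p != 0) s.2.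

Lemma splitsP P s : s \in splits P ->
  forall p, (p \in P) = (p \in s.1) || (p \in s.2).
Proof.
elim: P s => [|p0 P IHP] s /=; first by rewrite inE => /eqP ->.
rewrite mem_cat => /orP[] /mapP[t /IHP Ht ->] p; rewrite !inE Ht /=.
  by rewrite orbA.
by rewrite orbCA.
Qed.

(** Counting suits a partition indexed by positions, since repeated polynomials in [P] can produce
    repeated pairs. *)
Lemma count_splits x P : count (in_stratum x) (splits P) = 1%N.
Proof.
elim: P => //= p P IHP; rewrite count_cat !count_map.
have [p0|p0] := boolP (pol_eval phi x p == 0).
  rewrite [X in (_ + X)%N](eq_count (a2 := pred0)) ?count_pred0 ?addn0.
    by rewrite -[RHS]IHP; apply: eq_count => s; rewrite /in_stratum /= p0.
  by move=> s; rewrite /in_stratum /= p0 andbF.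
rewrite [X in (X + _)%N](eq_count (a2 := pred0)) ?count_pred0 ?add0n.
  by rewrite -[RHS]IHP; apply: eq_count => s; rewrite /in_stratum /= p0.
by move=> s; rewrite /in_stratum /= (negbTE p0).
Qed.

Definition typed (p : upol k) :
  pol k n := [seq (t.1, mnm_of_seq n t.2) | t <- p].

Lemma typedK p : pol_wf n p -> untype (typed p) = p.
Proof.
move=> /allP wf; rewrite /untype -map_comp -[RHS]map_id.
apply/eq_in_map => -[c m] /wf/eqP /= sz_m.
by rewrite mnm_of_seqK.
Qed.

Lemma zero_atE x (s : pol k n) :
  zero_at phi x s = (pol_eval phi x (untype s) == 0).
Proof.
rewrite /zero_at /mpoly_of_pol /pol_eval /untype big_map; congr (_ == 0).
elim: s => [|t s IHs]; first by rewrite !big_nil !rmorph0.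
rewrite !big_cons !rmorphD /= IHs map_mpolyZ map_mpolyX mevalZ mevalX.
congr (_ * _ + _); apply: eq_bigr => i _; by rewrite (mnm_nth 0%N).
Qed.

Definition stratum (s : seq (upol k) * seq (upol k)) : constr k n :=
  [:: (map typed s.1, [:: typed (pol_prod n s.2)])].

Lemma in_constr_stratum x s : all (pol_wf n) s.1 -> all (pol_wf n) s.2 ->
  in_constr phi (stratum s) x = in_stratum x s.
Proof.
move=> /allP wf1 wf2; rewrite /in_constr /= orbF /in_stratum all_map andbT.
congr (_ && _).
  by apply: eq_in_all => p /wf1 wf_p /=; rewrite zero_atE typedK.
rewrite zero_atE typedK ?pol_wf_prod // pol_eval_prod // prodf_seq_neq0.
by apply: eq_all.
Qed.

Lemma count1_exists_unique (T : Type) (d : T) (a : pred T) (s : seq T) :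
  count a s = 1%N -> exists! i : 'I_(size s), a (nth d s i).
Proof.
rewrite -sum1_count (big_nth d) big_mkord sum1_card => /mem_card1[i Hi].
exists i; split=> [|j Hj]; first by have := Hi i; rewrite [RHS]inE eqxx.
by apply/esym/eqP; have := Hi j; rewrite [RHS]inE => <-.
Qed.

Lemma strata_partition P : all (pol_wf n) P ->
  is_partition phi (map stratum (splits P)).
Proof.
move=> /allP wf_P x; apply: count1_exists_unique.
rewrite count_map -[RHS](count_splits x P); apply: eq_in_count =>
  s /splitsP Hs /=.
by apply: in_constr_stratum; apply/allP => p p_in; apply: wf_P;
  rewrite Hs p_in ?orbT.
Qed.

Lemma stratum_same_zeros x x' P s : s \in splits P ->
  in_stratum x s -> in_stratum x' s ->
  forall p, p \in P -> (pol_eval phi x p == 0) = (pol_eval phi x' p == 0).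
Proof.
move=> /splitsP Hs /andP[/allP z1 /allP nz1] /andP[/allP z2 /allP nz2] p.
rewrite Hs => /orP[p_in|p_in]; first by rewrite z1 ?z2.
by have := nz2 _ p_in; have := nz1 _ p_in => /= /negbTE -> /negbTE ->.
Qed.

End Partition.

(** * Agreement of the encodings *)

Section Encoding.
Variables (k : fieldType) (code : k -> tree) (n : nat).
#[local] Instance encodable_k : encodable k := encodable_field code.

Lemma tree_of_seq_map (A B : Type) (f : A -> B) (g : B -> tree) (s : seq A) :
  tree_of_seq g (map f s) = tree_of_seq (g \o f) s.
Proof. by elim: s => //= a s ->. Qed.

Lemma eq_in_tree_of_seq (A : eqType) (f g : A -> tree) (s : seq A) :
  {in s, f =1 g} -> tree_of_seq f s = tree_of_seq g s.
Proof.
elim: s => //= a s IHs fg; rewrite fg ?mem_head // IHs // => b b_in.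
by apply: fg; rewrite inE b_in orbT.
Qed.

Lemma tree_of_pol_untype (s : pol k n) :
  tree_of_pol code s = encode (untype s).
Proof. by rewrite /encode /encodable_seq /untype tree_of_seq_map. Qed.

Lemma tree_of_pols_untype (s : seq (pol k n)) :
  tree_of_seq (@tree_of_pol k code n) s = encode (map (@untype k n) s).
Proof.
rewrite /encode /encodable_seq tree_of_seq_map.
by elim: s => //= f s ->; rewrite tree_of_pol_untype.
Qed.

Lemma tree_of_typed (ps : seq (upol k)) : all (pol_wf n) ps ->
  tree_of_seq (@tree_of_pol k code n) (map (@typed k n) ps) = encode ps.
Proof.
move=> /allP wf; rewrite tree_of_pols_untype -map_comp; congr encode.
by rewrite -[RHS]map_id; apply/eq_in_map => p /wf; exact: typedK.
Qed.

Lemma tree_of_strata (P : seq (upol k)) : all (pol_wf n) P ->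
  tree_of_seq (@tree_of_constr k code n) (map (@stratum k n) (splits P)) =
  encode [seq [:: (s.1, [:: pol_prod n s.2])] | s <- splits P].
Proof.
move=> /allP wf_P; rewrite /encode /encodable_seq !tree_of_seq_map.
apply: eq_in_tree_of_seq => s /splitsP Hs /=.
have wf1 : all (pol_wf n) s.1 by apply/allP => p p_in; apply: wf_P;
  rewrite Hs p_in.
have wf2 : all (pol_wf n) s.2.
  by apply/allP => p p_in; apply: wf_P; rewrite Hs p_in orbT.
rewrite /tree_of_constr /= tree_of_typed //.
(* The single polynomial is viewed as the head of a one-element list, to which [tree_of_typed]
   applies. *)
by rewrite -[tree_of_pol _ _]/(left_tree (tree_of_seq (@tree_of_pol k code n)
  (map (@typed k n) [:: pol_prod n s.2]))) tree_of_typed //= pol_wf_prod.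
Qed.

End Encoding.

Theorem corollary0p2p1 (k : fieldType) (code : k -> tree)
    (k_computable : computable_field code)
    (K : fieldType) (iota : {rmorphism k -> K}) :
  exists algorithm : prog, forall (n : nat) (gens : seq (pol k n)),
    exists Ws : seq (constr k n),
      [/\ run algorithm
            (Node (tree_of_nat n) (tree_of_seq (@tree_of_pol k code n) gens))
            (tree_of_seq (@tree_of_constr k code n) Ws),
          is_partition iota Ws
        & forall W : constr k n, W \in Ws ->
            exists h : nat -> nat, forall x0 : 'I_n -> K,
              in_constr iota W x0 -> is_HSF iota (ideal_of_pols gens) x0 h].
Proof.
have [p Hp] := strata_program k_computable.
exists p => n gens.
pose ugens := map (@untype k n) gens.
pose st j := iter j (bad_step n.+1) (deg_bound ugens, [:: [::]]).
(* The least empty round is taken, as [strata_program] requires all earlier rounds to be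
   nonempty. *)
have [i nil_i min_i] := ex_minnP (bad_step_terminates n.+1 (deg_bound ugens)).
pose D := (st i).1.
pose P := pivots (size (cols n D)) (jet_matrix n D ugens).
have wf_P : all (pol_wf n) P by apply: pivots_wf; exact: jet_matrix_wf.
have Hgen (y : 'I_n -> K) b : initial_ideal iota gens y b -> exists w,
    [/\ (mdeg w <= D)%N, initial_ideal iota gens y w & (w <= b)%MM].
  case/(initial_idealE _ _ _ (deg_bound ugens)) => e He.
  have [e' [w [le_wD Hw le_wb]]] :=
    initial_degree_bound (translate_mdeg (gens := gens)) (leqnn _) nil_i He.
  by exists w; split=> //; apply/(initial_idealE _ _ _ (deg_bound ugens));
    exists e'.
exists (map (@stratum k n) (splits P)); split.
- rewrite tree_of_strata // tree_of_pols_untype; apply: Hp nil_i => j lt_ji.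
  by apply/negP => /min_i; rewrite leqNgt lt_ji.
- exact: strata_partition.
move=> _ /mapP[s s_in ->].
have in_stratumE x : in_constr iota (stratum n s) x = in_stratum iota x s.
  by apply: in_constr_stratum; apply/allP => p' p'_in; apply: (allP wf_P);
    rewrite (splitsP s_in) p'_in ?orbT.
(* A stratum without points admits any function; otherwise the function is read off at one of its
   points [x]. *)
have [[x Hx]|empty] := pselect (exists x : 'I_n -> K, in_stratum iota x s);
  last first.
  by exists (fun=> 0%N) => x0; rewrite in_stratumE => Hx0; case: empty;
    exists x0.
exists (fun r => size (standard_monomials iota gens x r)) => x0.
rewrite in_stratumE => Hx0.
have same := initial_ideal_locus Hgen (stratum_same_zeros s_in Hx Hx0).
rewrite (_ : (fun r => _) = fun r => size (standard_monomials iota gens x0 r)).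
  exact: is_HSF_standard.
apply/funext => r; congr size; apply: eq_filter => m.
by congr (~~ _); apply: asbool_equiv_eq; exact: same.
Qed.
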